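(* Assume that the flux $\mathbf{U}$ is locally conservative of degree $k\ge 2k_c=0$ (so $k_c=0$). Suppose that the problem $$\partial_tc+\nabla\cdot(\mathbf{U}c)=fc^*\ \text{ in }\Omega\times(0,\mathbb{T}],\qquad c=c_{\rm I}\ \text{ on }\Gamma_-=\{x\in\partial\Omega:\mathbf{U}\cdot\mathbf{n}<0\},\qquad c(\cdot,0)=c^0,$$ has nonnegative inflow data $c_{\rm I}$ and nonnegative initial condition $c^0$, and let $M=\max\{|c^0|,|c_{\rm I}|,|\widetilde c|\}$ (a constant, the maximum of the suprema of these functions). Then the numerical solution $C\in V_{h,0}$ obtained by the Brezzi--Marini--S\''uli (BMS) DG scheme with Euler time stepping satisfies positivity and the discrete maximum principle: $$0\le C\le M.$$
   Context: $\Omega\subset\mathbb{R}^d$ ($d=2,3$) is a bounded polygon/polyhedron with a shape-regular triangulation $\mathcal{T}_h$; $\mathbf{n}$ is the unit outward normal; $\mathcal{E}_h$ is the set of edges (faces); $k_c$ is the polynomial degree used to approximate the transport solution; $V_{h,0}$ is the space of functions that are constant on each $T\in\mathcal{T}_h$, and $\mathbb{P}_k(T)$ denotes polynomials of degree at most $k$ on $T$. The function $f$ is a source/sink term; $c^*=\widetilde c$ is prescribed where $f>0$ and $c^*$ equals the unknown concentration $c$ where $f<0$. $\mathbf{U}\in W^{1,\infty}(\Omega)$ and $\mathbf{U}\cdot\mathbf{n}_e$ does not change sign on each edge $e\in\mathcal{E}_h$, where $\mathbf{n}_e$ is the normal to $e$. $\mathbf{U}$ is called locally conservative of degree $k$ if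 for all $T\in\mathcal{T}_h$, $\int_T(\nabla\cdot\mathbf{U})w\,dx=\int_Tfw\,dx$ for all $w\in\mathbb{P}_k(T)$. Averages and jumps: on an interior edge shared by $T^\pm$ with outward normals $\mathbf{n}^\pm$, $\{\boldsymbol\tau\}=\frac12(\boldsymbol\tau^++\boldsymbol\tau^-)$ and $[\phi]=\phi^+\mathbf{n}^++\phi^-\mathbf{n}^-$; on boundary edges $\{\boldsymbol\tau\}=\boldsymbol\tau$ and $[\phi]=\phi\mathbf{n}$. BMS-DG scheme with Euler time discretization (here with $k_c=0$): given the old time level solution $C^{\rm old}$ (equal to $c^0$ at the first step and to the numerical solution of the previous step afterwards), find $C\in V_{h,0}$ such that for all $w\in V_{h,0}$ $$\sum_{T\in\mathcal{T}_h}\int_T\big(\gamma Cw-C(\mathbf{U}\cdot\nabla w)\big)dx+\sum_{e\not\subset\Gamma_-}\int_e\{\mathbf{U}C\}_u\cdot[w]\,ds=\int_\Omega fC^*w\,dx+\int_\Omega gw\,dx-\sum_{e\subset\Gamma_-}\int_e(\mathbf{U}\cdot\mathbf{n})c_{\rm I}w\,ds,$$ where $\gamma=1/\Delta t$ with $\Delta t$ the time step, $g=\gamma C^{\rm old}$, $C^*=\widetilde c$ where $f>0$ and $C^*=C$ where $f<0$, and $\{\mathbf{U}C\}_u$ is the upwind value: $\{\mathbf{U}C\}_u=\{C\mathbf{U}\}+\frac{|\mathbf{U}\cdot\mathbf{n}|}{2}[C]$ on interior edges and $\{\mathbf{U}C\}_u=\mathbf{U}C$ on boundary edges not in $\Ga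mma_-$.
   Formalization: The prescribed source concentration c̃ is additionally assumed nonnegative where f > 0; without this, positivity fails (e.g. U = x, f = d, c^0 = 0, c̃ = -1, no inflow boundary). *)

(* Defs.v *)
From HB Require Import structures.
From mathcomp Require Import all_boot all_order all_algebra.
From mathcomp Require Import all_classical all_reals all_analysis.

Set Implicit Arguments.
Unset Strict Implicit.
Unset Printing Implicit Defensive.

Import Order.TTheory GRing.Theory Num.Theory.
Import numFieldTopology.Exports numFieldNormedType.Exports.

Local Open Scope classical_set_scope.
Local Open Scope ring_scope.

(* Row vectors carry the sigma-algebra generated by their coordinates, as the
   library does for tuples. *)
Section measurable_rV.
Context {d} {T : measurableType d}.
Variable n : nat.

Let coors : 'I_n -> 'rV[T]_n -> T := fun i x => x ord0 i.

Let rV_set0 : g_sigma_preimage coors set0.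
Proof. exact: sigma_algebra0. Qed.

Let rV_setC A : g_sigma_preimage coors A -> g_sigma_preimage coors (~` A).
Proof. exact: sigma_algebraC. Qed.

Let rV_bigcup (F : _^nat) : (forall i, g_sigma_preimage coors (F i)) ->
  g_sigma_preimage coors (\bigcup_i (F i)).
Proof. exact: sigma_algebra_bigcup. Qed.

HB.instance Definition _ := @isMeasurable.Build (measure_tuple_display d)
  'rV[T]_n (g_sigma_preimage coors) rV_set0 rV_setC rV_bigcup.

End measurable_rV.

Section measurable_rV_fun.
Context d1 d2 (T1 : measurableType d1) (T2 : measurableType d2).

Lemma measurable_rV_coord n (i : 'I_n) :
  measurable_fun [set: 'rV[T2]_n] (fun x : 'rV[T2]_n => x ord0 i).
Proof.
move=> _ Y mY; rewrite setTI; apply: sub_sigma_algebra => /=.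
rewrite -bigcup_seq/=; exists i => /=; first by rewrite mem_index_enum.
by exists Y => //; rewrite setTI.
Qed.

Lemma measurable_fun_rV n (f : T1 -> 'rV[T2]_n) :
  (forall i, measurable_fun [set: T1] (fun x => f x ord0 i)) ->
  measurable_fun [set: T1] f.
Proof.
move=> mf.
suff : g_sigma_preimage (fun i x => f x ord0 i) `<=` measurable.
  pose c := fun (i : 'I_n) (x : 'rV[T2]_n) => x ord0 i.
  rewrite (_ : (fun i x => f x ord0 i) = (fun i => c i \o f)) //.
  by rewrite g_sigma_preimage_comp => H _ A mA; apply: H; exists A.
apply: smallest_sub; first exact: sigma_algebra_measurable.
case: n => [|n] in f mf *; first by rewrite big_ord0.
rewrite -bigcup_mkord_ord; apply: bigcup_sub => i Ii.
by move=> A [B mB <-]; exact: mf.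
Qed.

End measurable_rV_fun.

Lemma sigma_finite_product_measure d1 d2 (T1 : measurableType d1)
    (T2 : measurableType d2) (R : realType)
    (m1 : {sigma_finite_measure set T1 -> \bar R})
    (m2 : {sigma_finite_measure set T2 -> \bar R}) :
  sigma_finite setT (m1 \x m2)%E.
Proof.
have /sigma_finiteP[F [TF ndF Foo]] := sigma_finiteT m1.
have /sigma_finiteP[G [TG ndG Goo]] := sigma_finiteT m2.
exists (fun n => F n `*` G n).
  rewrite -setXTT TF TG predeqE => -[x y]; split.
    move=> [/= [n _ Fnx] [k _ Gky]]; exists (maxn n k) => //; split.
    - by move: x Fnx; exact/subsetPset/ndF/leq_maxl.
    - by move: y Gky; exact/subsetPset/ndG/leq_maxr.
  by move=> [n _ []/= ? ?]; split; exists n.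
move=> k; have [? ?] := Foo k; have [? ?] := Goo k.
split; first exact: measurableX.
by rewrite product_measure1E// lte_mul_pinfty// ge0_fin_numE.
Qed.

Section lebesgue_rV.
Context {R : realType}.

Definition rV_cons n (xy : R * 'rV[R]_n) : 'rV[R]_n.+1 :=
  \row_j oapp (fun k => xy.2 ord0 k) xy.1 (unlift ord0 j).

Definition rV_uncons n (z : 'rV[R]_n.+1) : R * 'rV[R]_n :=
  (z ord0 ord0, \row_j z ord0 (lift ord0 j)).

Lemma rV_consK n : cancel (@rV_cons n) (@rV_uncons n).
Proof.
case=> x y; rewrite /rV_uncons mxE unlift_none /=; congr pair.
by apply/rowP => j; rewrite !mxE liftK.
Qed.

Lemma rV_unconsK n : cancel (@rV_uncons n) (@rV_cons n).
Proof.
move=> z; apply/rowP => j; rewrite mxE.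
by case: unliftP => [k|] -> //=; rewrite mxE.
Qed.

Lemma measurable_rV_cons n : measurable_fun setT (@rV_cons n).
Proof.
apply: measurable_fun_rV => i; case: (unliftP ord0 i) => [k ->|->].
  rewrite (_ : (fun _ => _) = (fun x : 'rV[R]_n => x ord0 k) \o snd).
    exact: measurableT_comp (@measurable_rV_coord _ _ n k) measurable_snd.
  by apply/funext => z /=; rewrite mxE liftK.
rewrite (_ : (fun _ => _) = fst); first exact: measurable_fst.
by apply/funext => z /=; rewrite mxE unlift_none.
Qed.

Lemma measurable_rV_uncons n : measurable_fun setT (@rV_uncons n).
Proof.
apply: measurable_fun_pair => /=; first exact: measurable_rV_coord.
apply: measurable_fun_rV => i; under eq_fun do rewrite mxE.
exact: measurable_rV_coord.
Qed.

Section step.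
Variables (n : nat) (mu : {sigma_finite_measure set 'rV[R]_n -> \bar R}).

Definition rV_measure_cons : set 'rV[R]_n.+1 -> \bar R :=
  pushforward (@lebesgue_measure R \x mu)%E (@rV_cons n).

Let rVm0 : rV_measure_cons set0 = 0%E.
Proof. by rewrite /rV_measure_cons /pushforward preimage_set0 measure0. Qed.

Let rVm_ge0 A : (0 <= rV_measure_cons A)%E.
Proof. by rewrite /rV_measure_cons /pushforward; exact: measure_ge0. Qed.

Let rVm_sigma_additive : semi_sigma_additive rV_measure_cons.
Proof.
have mcons A : measurable A -> measurable (@rV_cons n @^-1` A).
  by move=> mA; rewrite -[X in measurable X]setTI; exact: measurable_rV_cons.
move=> F mF tF mUF; rewrite /rV_measure_cons /pushforward preimage_bigcup.
apply: measure_semi_sigma_additive.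
- by move=> i; exact: mcons.
- apply/trivIsetP => /= i j _ _ ij; rewrite -preimage_setI.
  by move/trivIsetP : tF => /(_ _ _ _ _ ij) ->//; rewrite preimage_set0.
- by rewrite -preimage_bigcup; exact: mcons.
Qed.

HB.instance Definition _ := isMeasure.Build _ _ _ rV_measure_cons
  rVm0 rVm_ge0 rVm_sigma_additive.

Let rVm_sigma_finite : sigma_finite setT rV_measure_cons.
Proof.
have [F FT Ffin] := sigma_finite_product_measure (@lebesgue_measure R) mu.
exists (fun i => @rV_uncons n @^-1` F i).
  by rewrite -preimage_bigcup -FT preimage_setT.
move=> i; have [mF Fi] := Ffin i; split.
  by rewrite -[X in measurable X]setTI; exact: measurable_rV_uncons.
rewrite /rV_measure_cons /pushforward -comp_preimage.
rewrite (_ : _ \o _ = id) //.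
by apply/funext => z /=; exact: rV_consK.
Qed.

HB.instance Definition _ := Measure_isSigmaFinite.Build _ _ _ rV_measure_cons
  rVm_sigma_finite.

End step.

Fixpoint lebesgue_rV n : {sigma_finite_measure set 'rV[R]_n -> \bar R} :=
  match n with
  | 0%N => dirac (0 : 'rV[R]_0)
  | k.+1 => rV_measure_cons (lebesgue_rV k)
  end.

End lebesgue_rV.

Section analysis.
Context {R : realType} {d : nat}.
Implicit Types (Om K : set 'rV[R]_d) (u phi : 'rV[R]_d -> R).

Definition dotp (x y : 'rV[R]_d) : R := \sum_i x ord0 i * y ord0 i.

(* The library norm on matrices is the sup norm. *)
Definition enorm (x : 'rV[R]_d) : R := Num.sqrt (dotp x x).

Definition partial (i : 'I_d) phi (x : 'rV[R]_d) : R :=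
  'D_(delta_mx ord0 i) phi x.

Definition grad phi (x : 'rV[R]_d) : 'rV[R]_d := \row_i partial i phi x.

Definition poly_fun (k : nat) phi : Prop :=
  exists a : {ffun 'I_d -> 'I_k.+1} -> R, forall x,
    phi x = \sum_(m : {ffun 'I_d -> 'I_k.+1} | (\sum_i m i <= k)%N)
              a m * \prod_i x ord0 i ^+ m i.

Definition ess_bounded Om u : Prop :=
  measurable_fun Om u /\
  exists B : R, {ae lebesgue_rV d, forall x, Om x -> `|u x| <= B}.

Definition C1_c Om phi : Prop :=
  [/\ exists K, [/\ compact K, K `<=` Om & forall x, ~ K x -> phi x = 0],
      continuous phi,
      forall i x, derivable phi x (delta_mx ord0 i) &
      forall i, continuous (partial i phi)].

(* g is the weak derivative of u along the i-th axis; test functions are C^1_c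
   as in Gilbarg-Trudinger, Section 7.3. *)
Definition weak_partial Om i u g : Prop :=
  forall phi, C1_c Om phi ->
    \int[lebesgue_rV d]_(x in Om) (u x * partial i phi x) =
    - \int[lebesgue_rV d]_(x in Om) (g x * phi x).

(* U belongs to W^{1,oo}(Om) with weak Jacobian DU, where (DU x) i j stands for
   d U_i / d x_j; the divergence of U is then x |-> \tr (DU x). *)
Definition W1oo Om (U : 'rV[R]_d -> 'rV[R]_d) (DU : 'rV[R]_d -> 'M[R]_d) :
    Prop :=
  [/\ forall i, ess_bounded Om (fun x => U x ord0 i),
      forall i j, ess_bounded Om (fun x => DU x i j) &
      forall i j, weak_partial Om j (fun x => U x ord0 i) (fun x => DU x i j)].

End analysis.

(* Cells and faces are represented by their sets of vertices. *)
Record mesh (R : realType) (d : nat) := Mesh {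
  node : finType;
  pos : node -> 'rV[R]_d;
  cells : {set {set node}} }.

Section mesh_theory.
Context {R : realType} {d : nat}.
Variable m : mesh R d.
Implicit Types (S T F : {set node m}) (x nu : 'rV[R]_d).

Definition csimplex S : set 'rV[R]_d :=
  [set x | exists a : node m -> R,
    [/\ forall v, v \in S -> 0 <= a v, \sum_(v in S) a v = 1 &
        x = \sum_(v in S) a v *: pos v]].

Definition osimplex S : set 'rV[R]_d :=
  [set x | exists a : node m -> R,
    [/\ forall v, v \in S -> 0 < a v, \sum_(v in S) a v = 1 &
        x = \sum_(v in S) a v *: pos v]].

Definition affine_free S : Prop :=
  forall a : node m -> R, \sum_(v in S) a v = 0 ->
    \sum_(v in S) a v *: pos v = 0 -> forall v, v \in S -> a v = 0.

(* A conforming triangulation of the polygon/polyhedron Om: Om is a connected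
   regular open set whose closure is a finite union of d-simplices, any two of
   which meet along a common (possibly empty) face. *)
Definition triangulation (Om : set 'rV[R]_d) : Prop :=
  [/\ Om !=set0 /\ connected Om, Om = interior (closure Om),
      closure Om = [set x | exists2 T, T \in cells m & csimplex T x],
      forall T, T \in cells m -> #|T| = d.+1 /\ affine_free T &
      forall T1 T2, T1 \in cells m -> T2 \in cells m ->
        csimplex T1 `&` csimplex T2 = csimplex (T1 :&: T2)].

Definition diameter (A : set 'rV[R]_d) : R :=
  sup [set r | exists x y, [/\ A x, A y & r = enorm (x - y)]].

Definition inradius (A : set 'rV[R]_d) : R :=
  sup [set r | 0 <= r /\ exists x, forall y, enorm (y - x) <= r -> A y].

Definition shape_regular (kappa : R) : Prop :=
  forall T, T \in cells m ->
    diameter (csimplex T) <= kappa * inradius (csimplex T).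

(* The elements of E_h: edges when d = 2, faces when d = 3. *)
Definition is_face F : bool :=
  (#|F| == d) && [exists T in cells m, F \subset T].

Definition nb_cells F : nat := #|[pred T in cells m | F \subset T]|.

Definition interior_face F : bool := is_face F && (nb_cells F == 2)%N.

Definition boundary_face F : bool := is_face F && (nb_cells F == 1)%N.

Definition unit_normal F nu : Prop :=
  dotp nu nu = 1 /\
  forall u v, u \in F -> v \in F -> dotp nu (pos u - pos v) = 0.

(* n_e; its orientation is unspecified, and immaterial below. *)
Definition face_normal F : 'rV[R]_d := xget 0 [set nu | unit_normal F nu].

Definition outward_normal T F : 'rV[R]_d :=
  xget 0 [set nu | unit_normal F nu /\
    forall v w, v \in F -> w \in T -> w \notin F ->
      dotp nu (pos w - pos v) < 0].

(* Surface integral over F, by the affine parametrization of F with vertices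
   p_0, ..., p_(d-1) over the reference simplex of R^(d-1); the rows of the
   Jacobian matrix J are p_(i+1) - p_0 and the area factor is
   sqrt (det (J J^T)). *)
Definition face_vertex F (i : nat) : 'rV[R]_d :=
  nth 0 [seq pos v | v <- enum F] i.

Definition face_jacobian F : 'M[R]_(d.-1, d) :=
  \matrix_(i < d.-1) (face_vertex F i.+1 - face_vertex F 0).

Definition reference_simplex n : set 'rV[R]_n :=
  [set s | (forall i, 0 < s ord0 i) /\ \sum_i s ord0 i < 1].

Definition face_integral F (g : 'rV[R]_d -> R) : R :=
  Num.sqrt (\det (face_jacobian F *m (face_jacobian F)^T)) *
  \int[lebesgue_rV d.-1]_(s in @reference_simplex d.-1)
    g (face_vertex F 0 + s *m face_jacobian F).

(* Piecewise functions: phi T is the restriction of phi to the cell T, so that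
   the trace of phi on a face F from a cell T containing F is phi T on F. *)
Definition broken := {set node m} -> 'rV[R]_d -> R.

Definition V_h0 (phi : broken) : Prop :=
  forall T, T \in cells m -> exists c : R, forall x, phi T x = c.

Definition average F (tau : {set node m} -> 'rV[R]_d -> 'rV[R]_d) x :
    'rV[R]_d :=
  (nb_cells F)%:R^-1 *: \sum_(T in cells m | F \subset T) tau T x.

Definition jump F (phi : broken) x : 'rV[R]_d :=
  \sum_(T in cells m | F \subset T) phi T x *: outward_normal T F.

Definition upwind (U : 'rV[R]_d -> 'rV[R]_d) F (C : broken) x : 'rV[R]_d :=
  average F (fun T y => C T y *: U y) x +
  (if interior_face F
   then (`|dotp (U x) (face_normal F)| / 2) *: jump F C x else 0).

(* The normal to the boundary of Om is defined inside boundary faces only. *)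
Definition Gamma_minus (Om : set 'rV[R]_d) (U : 'rV[R]_d -> 'rV[R]_d) :
    set 'rV[R]_d :=
  [set x | (closure Om `\` Om) x /\
    exists T F, [/\ T \in cells m, F \subset T, boundary_face F,
      osimplex F x & dotp (U x) (outward_normal T F) < 0]].

Definition inflow_face (Om : set 'rV[R]_d) (U : 'rV[R]_d -> 'rV[R]_d) F :
    bool :=
  boundary_face F && `[< osimplex F `<=` Gamma_minus Om U >].

Definition constant_sign (U : 'rV[R]_d -> 'rV[R]_d) : Prop :=
  forall F, is_face F ->
    (forall x, csimplex F x -> 0 <= dotp (U x) (face_normal F)) \/
    (forall x, csimplex F x -> dotp (U x) (face_normal F) <= 0).

Definition locally_conservative (k : nat) (DU : 'rV[R]_d -> 'M[R]_d)
    (f : 'rV[R]_d -> R) : Prop :=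
  forall T, T \in cells m -> forall w, poly_fun k w ->
    \int[lebesgue_rV d]_(x in osimplex T) (\tr (DU x) * w x) =
    \int[lebesgue_rV d]_(x in osimplex T) (f x * w x).

(* C^*; its value where f = 0 is irrelevant, as it only enters through f C^*. *)
Definition C_star (f ct : 'rV[R]_d -> R) (C : broken) : broken :=
  fun T x => if 0 < f x then ct x else C T x.

(* One implicit Euler step of the BMS scheme with k_c = 0, where
   gamma = 1 / dt, and ct, cI are the source and inflow concentrations at the
   new time level. *)
Definition BMS_step (Om : set 'rV[R]_d) (U : 'rV[R]_d -> 'rV[R]_d)
    (f ct cI : 'rV[R]_d -> R) (dt : R) (Cold C : broken) : Prop :=
  let gamma := dt^-1 in
  V_h0 C /\
  forall w : broken, V_h0 w ->
    \sum_(T in cells m) \int[lebesgue_rV d]_(x in osimplex T)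
        (gamma * C T x * w T x - C T x * dotp (U x) (grad (w T) x))
    + \sum_(F | is_face F && ~~ inflow_face Om U F)
        face_integral F (fun x => dotp (upwind U F C x) (jump F w x))
    = \sum_(T in cells m) \int[lebesgue_rV d]_(x in osimplex T)
        (f x * C_star f ct C T x * w T x)
    + \sum_(T in cells m) \int[lebesgue_rV d]_(x in osimplex T)
        (gamma * Cold T x * w T x)
    - \sum_(F | inflow_face Om U F) face_integral F (fun x =>
        \sum_(T in cells m | F \subset T)
          dotp (U x) (outward_normal T F) * cI x * w T x).

End mesh_theory.

(* The maximum of the suprema of |c0| over Om, of |cI| over (0, Tf] x Gamma_-,
   and of |ct| over (0, Tf] x {f > 0}, where ct is prescribed. *)
Definition data_max {R : realType} {d : nat} (Om Gm : set 'rV[R]_d) (Tf : R)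
    (f c0 : 'rV[R]_d -> R) (cI ct : R -> 'rV[R]_d -> R) : \bar R :=
  maxe (ereal_sup [set y | exists2 x, Om x & y = `|c0 x|%:E])
    (maxe
      (ereal_sup [set y | exists t x,
         [/\ 0 < t <= Tf, Gm x & y = `|cI t x|%:E]])
      (ereal_sup [set y | exists t x,
         [/\ 0 < t <= Tf, Om x, 0 < f x & y = `|ct t x|%:E]])).

(* Main.v *)
Require Import Defs.
From mathcomp Require Import all_boot all_order all_algebra.
From mathcomp Require Import all_classical all_reals all_analysis.
From mathcomp Require Import measurable_realfun ring lra.

Set Implicit Arguments.
Unset Strict Implicit.
Unset Printing Implicit Defensive.

Import Order.TTheory GRing.Theory Num.Theory.
Import numFieldTopology.Exports numFieldNormedType.Exports.

Local Open Scope classical_set_scope.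
Local Open Scope ring_scope.

(** Test functions that are constant on cells have zero gradient, so testing the
    scheme with the indicator of a cell T (cell_equation) gives, for the cell
    values c_T of the solution,

      |T| c_T / dt + (upwind outflow) + (prescribed inflow)
        = (integral over T of f C^* ) + (integral over T of Cold) / dt.

    On a face of T where U points outward the upwind flux carries c_T, and where
    it points inward it carries either the value of the neighbour or the inflow
    datum.  Replace every neighbouring value, every datum and the source value by
    c_T: the fluxes add up to c_T times the total flux of U through the boundary
    of T, and the source to c_T times the integral of f.  The two agree
    (flux_balance), since the flux is the integral of div U over T and local
    conservation, tested with the constant 1, equates that with the integral
    of f.

    Now let T be a cell where c is minimal, let K be a lower bound of the data,
    and suppose c_T < K.  None of the replacements then increases what enters
    T: the inward flux and the positive part of f are multiplied by something no
    larger.  What remains is |T| c_T / dt >= |T| K / dt, which contradicts c_T < K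
    (minimal_cell_bound).  So every lower bound of the data is one of the solution.
    With K = 0 this is positivity.  The scheme is linear, so (- C) solves it with
    opposite data (BMS_step_oppr), and K = - M for the opposite problem is the
    upper bound.  Induction over the time steps concludes.

    The substance is the divergence theorem on a simplex for a continuous field
    whose weak Jacobian is bounded (divergence_cell).  The weak derivative is
    tested with products of one-dimensional cut-offs of the barycentric
    coordinates lambda_v / delta.  Such a product tends to 1 inside T as delta
    tends to 0, and its gradient is a sum over the vertices w of grad lambda_w
    times a function that concentrates on the face opposite to w.  In the affine
    chart whose first coordinate is lambda_w / delta that function becomes a bump
    of integral 1 in the first variable, so dominated convergence turns its
    integral against a continuous u into |det A| times the integral of u over the
    face, parametrized by the reference simplex; the rows of A are edges of T
    (layer_limit).  The outward normal is - grad lambda_w / |grad lambda_w|, and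
    the identity sqrt (det (J J^T)) = |det A| |grad lambda_w|, read off the
    adjugate of the Gram matrix (area_factor), turns the limits into the face
    integrals of the normal flux. *)

(** * Borel sets and Lebesgue measure of row vectors *)

Section rV_borel.
Context {R : realType}.

Definition box n (c : 'rV[R]_n) (r : R) : set 'rV[R]_n :=
  [set x | forall i, `|x ord0 i - c ord0 i| < r].

Lemma measurable_box n (c : 'rV[R]_n) (r : R) : measurable (box c r).
Proof.
rewrite (_ : box c r = \big[setI/setT]_(i < n)
   ((fun x : 'rV[R]_n => x ord0 i) @^-1` ball (c ord0 i) r)); last first.
  apply/seteqP; split => [x /= xcr|x].
    rewrite -bigcap_seq => i _ /=; rewrite /ball /=.
    by rewrite distrC xcr.
  rewrite -bigcap_seq /= => xcr i.
  have := xcr i (mem_index_enum i).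
  by rewrite /ball /= distrC.
apply: bigsetI_measurable => i _.
rewrite -[X in measurable X]setTI.
by apply: measurable_rV_coord => //; exact: measurable_realfun.measurable_ball.
Qed.

(** The sigma-algebra is generated by the coordinates; an open set is the union
    of the countably many rational boxes that it contains. *)
Lemma open_measurable_rV n (A : set 'rV[R]_n) : open A -> measurable A.
Proof.
move=> oA.
(* box with rational centre qr.1 and radius 1 / (qr.2 + 1) *)
pose B (qr : 'rV[rat]_n * nat) : set 'rV[R]_n :=
  [set x | forall i, `|x ord0 i - ratr (qr.1 ord0 i)| < qr.2.+1%:R^-1].
have -> : A = \bigcup_(k : nat)
    (if unpickle k is Some qr then
       if `[< B qr `<=` A >] then B qr else set0 else set0).
  apply/seteqP; split => [x Ax|x [k _]]; last first.
    by case: unpickle => [qr|//]; case: asboolP => // + Bx; exact.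
  have /nbhs_ballP[e /= e0 eA] := open_nbhs_nbhs (conj oA Ax).
  have [k ke] : exists k, k.+1%:R^-1 < e / 2.
    by have [k _ /(_ _ (leqnn k))] := near_infty_natSinv_lt (PosNum (divr_gt0 e0 (ltr0Sn R 1))); exists k.
  have [q qx] : exists q : 'rV[rat]_n, forall i, `|x ord0 i - ratr (q ord0 i)| < k.+1%:R^-1.
    have P i : exists q : rat, `|x ord0 i - ratr q| < k.+1%:R^-1.
      have /rat_in_itvoo[q] : x ord0 i - k.+1%:R^-1 < x ord0 i + k.+1%:R^-1.
        by rewrite ltrD2l gtrN// invr_gt0.
      by rewrite in_itv/= => /andP[q1 q2]; exists q; rewrite distrC ltr_distl q1 q2.
    by exists (\row_i projT1 (cid (P i))) => i; rewrite mxE; case: cid.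
  exists (pickle (q, k)) => //; rewrite pickleK; case: asboolP => [_|[]].
    by move=> i /=.
  move=> y By; apply: eA; split => // i j; rewrite (ord1 i) /ball/=.
  suff : `|x ord0 j - y ord0 j| < e by [].
  have := By j; have := qx j => /=.
  move=> xq yq; apply: le_lt_trans (ler_distD (ratr (q ord0 j)) _ _) _.
  by rewrite (splitr e) ltrD ?(lt_trans _ ke)// distrC.
apply: bigcupT_measurable => k; case: unpickle => [qr|]; last exact: measurable0.
case: ifPn => _; last exact: measurable0.
rewrite (_ : B qr = box (map_mx ratr qr.1) qr.2.+1%:R^-1).
  exact: measurable_box.
by apply/seteqP; split => x Bx i; have := Bx i; rewrite mxE.
Qed.

Lemma within_continuous_measurable_rV n (D : set 'rV[R]_n) (f : 'rV[R]_n -> R) :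
  measurable D -> {within D, continuous f} -> measurable_fun D f.
Proof.
move=> mD /continuousP cf; apply: (measurability _ (RGenOpens.measurableE R)).
move=> _ [_ [a [b ->] <-]].
have /open_subspaceP [V oV VD] : open (f @^-1` `]a, b[%classic : set (subspace D)).
  by apply: cf; exact: interval_open.
rewrite setIC -VD; apply: measurableI => //; exact: open_measurable_rV.
Qed.

Lemma continuous_measurable_rV n (f : 'rV[R]_n -> R) :
  continuous f -> measurable_fun setT f.
Proof.
move=> cf; apply: within_continuous_measurable_rV => //.
by apply: continuous_subspaceT.
Qed.

End rV_borel.

(** The pushforward as a measure structure, indexed by the measurability proof
    so that it can be named in a rewriting step. *)
Definition image_measure d d' (T1 : measurableType d) (T2 : measurableType d')
    (R : realFieldType) (m : {measure set T1 -> \bar R}) (f : T1 -> T2)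
    (mf : measurable_fun [set: T1] f) : {measure set T2 -> \bar R} :=
  measure_function_pushforward__canonical__measure_function_Measure m mf.

Section lebesgue_affine.
Context {R : realType}.
Local Notation leb := (@lebesgue_measure R).
Local Notation mu := (@lebesgue_rV R).

Lemma lebesgue_measure_shift (b : R) (A : set R) : measurable A ->
  leb ((fun x => x + b) @^-1` A) = leb A.
Proof.
move=> mA.
have mf : measurable_fun setT (fun x : R => x + b) by exact: measurable_funD.
apply/esym/(@lebesgue_measure_unique R
  (image_measure leb (mf : @measurable_fun _ _ (measurableTypeR R) (measurableTypeR R) _ _))) => //.
move=> _ [[x y] _ <-]; rewrite /pushforward /=.
rewrite [pushforward _ _ _](_ : _ = leb `]x - b, y - b]%classic); last first.
  congr (leb _); apply/seteqP; split => z /=; rewrite !in_itv/=.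
    by rewrite ltrBlDr lerBrDr.
  by rewrite ltrBlDr lerBrDr.
rewrite !lebesgue_measure_itv /= !lte_fin ltrD2r; case: ifP => // _.
  by rewrite -!EFinD; congr EFin; lra.
Qed.

(** Lebesgue measure is determined by its values on half-open intervals; a
    negative factor reverses them, which only exchanges end points. *)
Lemma lebesgue_measure_dilation (a : R) (A : set R) : a != 0 -> measurable A ->
  leb ((fun x => a * x) @^-1` A) = (`|a|^-1%:E * leb A)%E.
Proof.
move=> a0 mA.
have mf : measurable_fun setT (fun x : R => a * x) by exact: mulrl_measurable.
have a0' : 0 < `|a| by rewrite normr_gt0.
pose k := NngNum (ltW a0').
pose m := image_measure leb (mf : @measurable_fun _ _ (measurableTypeR R) (measurableTypeR R) _ _).
suff: leb A = mscale k m A.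
  rewrite /mscale/= /pushforward => ->.
  by rewrite muleA -EFinM mulVf ?mul1e// gt_eqF.
apply: (@lebesgue_measure_unique R (mscale k m)) => //.
move=> _ [[x y] _ <-] /=.
change (leb `]x, y]%classic = (`|a|%:E * m `]x, y]%classic)%E).
have [an|ap|ae] := ltgtP a 0; last by rewrite ae eqxx in a0.
  have -> : m `]x, y]%classic = leb `[y / a, x / a[%classic.
    congr (leb _); apply/seteqP; split => z /=;
    by rewrite !in_itv/= ler_ndivrMr// ltr_ndivlMr// mulrC andbC.
  rewrite !lebesgue_measure_itv /= !lte_fin ltr_nM2r ?invr_lt0//.
  case: ifP => // _; last by rewrite mule0.
  by rewrite -!EFinD -EFinM ltr0_norm//; congr EFin; field.
have -> : m `]x, y]%classic = leb `]x / a, y / a]%classic.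
  congr (leb _); apply/seteqP; split => z /=;
  by rewrite !in_itv/= ler_pdivlMr// ltr_pdivrMr// mulrC.
rewrite !lebesgue_measure_itv /= !lte_fin ltr_pM2r ?invr_gt0//.
case: ifP => // _; last by rewrite mule0.
by rewrite -!EFinD -EFinM gtr0_norm//; congr EFin; field.
Qed.

Lemma lebesgue_rVS n (A : set 'rV[R]_n.+1) :
  mu n.+1 A = (leb \x mu n)%E (@rV_cons R n @^-1` A).
Proof. by []. Qed.

Lemma measurable_rV_cons_preimage n (A : set 'rV[R]_n.+1) : measurable A ->
  measurable (@rV_cons R n @^-1` A).
Proof. by move=> mA; rewrite -[X in measurable X]setTI; exact: measurable_rV_cons. Qed.

(** The definition of the measure of 'rV_(n+1) integrates the sections over the
    first coordinate; the next lemma is the other order of integration. *)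
Lemma lebesgue_rV_xsection n (A : set 'rV[R]_n.+1) :
  mu n.+1 A = (\int[leb]_x mu n [set y | A (rV_cons (x, y))])%E.
Proof.
rewrite lebesgue_rVS /product_measure1; apply: eq_integral => x _ /=; congr (mu n _).
by apply/seteqP; split => y; rewrite /xsection /= inE.
Qed.

Lemma lebesgue_rV_ysection n (A : set 'rV[R]_n.+1) : measurable A ->
  mu n.+1 A = (\int[mu n]_y leb [set x | A (rV_cons (x, y))])%E.
Proof.
move=> mA; rewrite lebesgue_rVS.
rewrite (product_measure_unique (m' := (leb \x^ mu n)%E)); last first.
- exact: measurable_rV_cons_preimage.
- by move=> X Y mX mY; exact: product_measure2E.
rewrite /product_measure2; apply: eq_integral => y _ /=; congr (leb _).
by apply/seteqP; split => x; rewrite /ysection /= inE.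
Qed.

Lemma measurable_rV_xsection n (A : set 'rV[R]_n.+1) x : measurable A ->
  measurable [set y | A (rV_cons (x, y))].
Proof.
move=> /measurable_rV_cons_preimage mA.
have -> : [set y | A (rV_cons (x, y))] = xsection (@rV_cons R n @^-1` A) x.
  by apply/seteqP; split => y; rewrite /xsection /= inE.
exact: measurable_xsection.
Qed.

Lemma measurable_rV_ysection n (A : set 'rV[R]_n.+1) y : measurable A ->
  measurable [set x | A (rV_cons (x, y))].
Proof.
move=> /measurable_rV_cons_preimage mA.
have -> : [set x | A (rV_cons (x, y))] = ysection (@rV_cons R n @^-1` A) y.
  by apply/seteqP; split => x; rewrite /ysection /= inE.
exact: measurable_ysection.
Qed.

End lebesgue_affine.

(** * Linear change of variables *)

Section linear_change_of_variables.
Context {R : realType}.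
Local Notation leb := (@lebesgue_measure R).
Local Notation mu := (@lebesgue_rV R).

(** Stated for the preimages of all measurable sets, this notion is stable
    under composition and passes to integrals by pushforward; for an invertible
    matrix A acting on rows, k is the inverse of |det A|. *)
Definition scales n (phi : 'rV[R]_n -> 'rV[R]_n) (k : R) : Prop :=
  [/\ 0 <= k, measurable_fun setT phi &
      forall A, measurable A -> mu n (phi @^-1` A) = (k%:E * mu n A)%E].

Lemma scales_comp n (phi psi : 'rV[R]_n -> 'rV[R]_n) k l :
  scales phi k -> scales psi l -> scales (psi \o phi) (l * k).
Proof.
move=> [k0 mphi phiE] [l0 mpsi psiE]; split; first exact: mulr_ge0.
  exact: measurableT_comp.
move=> A mA; rewrite comp_preimage phiE; last first.
  by rewrite -[X in measurable X]setTI; exact: mpsi.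
by rewrite psiE// muleA EFinM (muleC k%:E).
Qed.

Lemma measurable_mulmx n p (A : 'M[R]_(n, p)) :
  measurable_fun setT (fun x : 'rV[R]_n => x *m A).
Proof.
apply: measurable_fun_rV => i; under eq_fun do rewrite mxE.
apply: measurable_sum => j.
by apply: measurable_funM => //; exact: measurable_rV_coord.
Qed.

Lemma measurable_addmx n p (f g : 'rV[R]_n -> 'rV[R]_p) :
  measurable_fun setT f -> measurable_fun setT g ->
  measurable_fun setT (fun x => f x + g x).
Proof.
move=> mf mg; apply: measurable_fun_rV => i; under eq_fun do rewrite mxE.
by apply: measurable_funD; [
  exact: (measurableT_comp (measurable_rV_coord i) mf)|
  exact: (measurableT_comp (measurable_rV_coord i) mg)].
Qed.

Lemma rV_consE n x (y : 'rV[R]_n) :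
  rV_cons (x, y) = row_mx (x%:M : 'M[R]_1) y :> 'rV_(1 + n).
Proof.
apply/rowP => j; rewrite mxE; case: (unliftP ord0 j) => [k ->|->] /=.
  by rewrite (_ : lift ord0 k = rshift 1 k) ?row_mxEr//; apply/val_inj.
rewrite (_ : ord0 = lshift n (ord0 : 'I_1)) ?row_mxEl ?mxE//.
exact/val_inj.
Qed.

Lemma rV_consP n (z : 'rV[R]_n.+1) : exists x y, z = rV_cons (x, y).
Proof.
by exists (rV_uncons z).1, (rV_uncons z).2; rewrite -surjective_pairing rV_unconsK.
Qed.

(** The first coordinate is fixed and the others are transformed on each slice:
    Tonelli. *)
Lemma scales_tail n (phi : 'rV[R]_n.+1 -> 'rV[R]_n.+1) psi k :
  measurable_fun setT phi ->
  (forall x y, phi (rV_cons (x, y)) = rV_cons (x, psi x y)) ->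
  (forall x, scales (psi x) k) -> scales phi k.
Proof.
move=> mphi phiE psik; have [k0 _ _] := psik 0.
split => // A mA.
rewrite !lebesgue_rV_xsection -ge0_integralZl//.
- apply: eq_integral => x _; have [_ _ <-] := psik x.
    by congr (mu n _); apply/seteqP; split => y /=; rewrite phiE.
  exact: measurable_rV_xsection.
- have := measurable_fun_xsection (mu n) (measurable_rV_cons_preimage mA).
  congr (measurable_fun _ _); apply/funext => x /=; congr (mu n _).
  by apply/seteqP; split => y; rewrite /xsection /= inE.
Qed.

(** Tonelli again, integrating the first coordinate first. *)
Lemma scales_head n (phi : 'rV[R]_n.+1 -> 'rV[R]_n.+1) psi k :
  measurable_fun setT phi ->
  (forall x y, phi (rV_cons (x, y)) = rV_cons (psi y x, y)) -> 0 <= k ->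
  (forall y (A : set R), measurable A -> leb (psi y @^-1` A) = (k%:E * leb A)%E) ->
  scales phi k.
Proof.
move=> mphi phiE k0 psik; split => // A mA.
have mA' : measurable (phi @^-1` A).
  by rewrite -[X in measurable X]setTI; exact: mphi.
rewrite !lebesgue_rV_ysection// -ge0_integralZl//.
- apply: eq_integral => y _; rewrite -(psik y).
    by congr (leb _); apply/seteqP; split => x /=; rewrite phiE.
  exact: measurable_rV_ysection.
- have := measurable_fun_ysection leb (measurable_rV_cons_preimage mA).
  congr (measurable_fun _ _); apply/funext => y /=; congr (leb _).
  by apply/seteqP; split => x; rewrite /ysection /= inE.
Qed.

Lemma scales_translation n (b : 'rV[R]_n) : scales (fun x => x + b) 1.
Proof.
have mb m (c : 'rV[R]_m) : measurable_fun setT (fun x : 'rV[R]_m => x + c).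
  by apply: measurable_addmx => //; exact: measurable_id.
elim: n b => [|n ih] b.
  split => // A mA; rewrite mul1e; congr (mu 0 _).
  by apply/seteqP; split => x /=; rewrite [b]thinmx0 addr0.
have [b0 [b1 ->]] := rV_consP b.
pose h := fun x : 'rV[R]_n.+1 => x + rV_cons (b0, 0 : 'rV_n).
pose t := fun x : 'rV[R]_n.+1 => x + rV_cons (0, b1).
have -> : (fun x => x + rV_cons (b0, b1)) = t \o h.
  apply/funext => x; rewrite /t /h /= -addrA; congr (_ + _).
  by apply/rowP => j; rewrite !mxE; case: unliftP => [k _|_] /=; rewrite ?mxE ?add0r ?addr0.
have addE x y c0 (c1 : 'rV[R]_n) : rV_cons (x, y) + rV_cons (c0, c1) = rV_cons (x + c0, y + c1).
  by apply/rowP => j; rewrite !mxE; case: unliftP => [k _|_] /=; rewrite ?mxE.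
rewrite -[1]mulr1; apply: scales_comp.
  apply: (@scales_head _ _ (fun _ x => x + b0)) => //.
  - exact: mb.
  - by move=> x y; rewrite /h addE addr0.
  - by move=> y A mA; rewrite mul1e; exact: lebesgue_measure_shift.
apply: (@scales_tail _ _ (fun _ y => y + b1)) => //; first exact: mb.
by move=> x y; rewrite /t addE addr0.
Qed.

Lemma rV_cons_mul_block n x (y : 'rV[R]_n) a r c (S : 'M[R]_n) :
  rV_cons (x, y) *m (block_mx (a%:M : 'M[R]_1) r c S : 'M[R]_n.+1) =
  rV_cons (x * a + (y *m c) 0 0, x *: r + y *m S).
Proof.
rewrite [RHS]rV_consE.
transitivity (row_mx (x%:M : 'M[R]_1) y *m block_mx (a%:M : 'M[R]_1) r c S).
  by rewrite -rV_consE.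
rewrite (mul_row_block x%:M y) mul_scalar_mx.
congr (@row_mx R 1 1 n _ _).
  by rewrite {1}[y *m c]mx11_scalar scale_scalar_mx -raddfD.
by rewrite mul_scalar_mx.
Qed.

Lemma scales_shear_tail n (r : 'rV[R]_n) :
  scales (fun x => x *m (block_mx (1%:M : 'M[R]_1) r 0 1%:M : 'M[R]_n.+1)) 1.
Proof.
apply: (@scales_tail _ _ (fun x y => y + x *: r)).
- exact: measurable_mulmx.
- move=> x y; rewrite rV_cons_mul_block.
  by rewrite mulr1 mulmx0 mxE addr0 mulmx1 addrC.
- by move=> x; exact: scales_translation.
Qed.

Lemma scales_shear_head n (c : 'cV[R]_n) :
  scales (fun x => x *m (block_mx (1%:M : 'M[R]_1) 0 c 1%:M : 'M[R]_n.+1)) 1.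
Proof.
apply: (@scales_head _ _ (fun y x => x + (y *m c) 0 0)) => //.
- exact: measurable_mulmx.
- move=> x y; rewrite rV_cons_mul_block.
  by rewrite mulr1 scaler0 add0r mulmx1.
- by move=> y A mA; rewrite mul1e; exact: lebesgue_measure_shift.
Qed.

Lemma scales_dilation n (a : R) : a != 0 ->
  scales (fun x => x *m (block_mx (a%:M : 'M[R]_1) 0 0 1%:M : 'M[R]_n.+1)) `|a|^-1.
Proof.
move=> a0; apply: (@scales_head _ _ (fun y x => a * x)) => //.
- exact: measurable_mulmx.
- move=> x y; rewrite rV_cons_mul_block.
  by rewrite mulmx0 mxE addr0 mulrC scaler0 add0r mulmx1.
- by move=> y A mA; exact: lebesgue_measure_dilation.
Qed.

Lemma scales_block n (S : 'M[R]_n) k : scales (fun x => x *m S) k ->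
  scales (fun x => x *m (block_mx (1%:M : 'M[R]_1) 0 0 S : 'M[R]_n.+1)) k.
Proof.
move=> Sk; apply: (@scales_tail _ _ (fun x y => y *m S)) => //.
- exact: measurable_mulmx.
- move=> x y; rewrite rV_cons_mul_block.
  by rewrite mulr1 mulmx0 mxE addr0 scaler0 add0r.
Qed.

(** Induction on the dimension by block elimination. When the upper left entry
    is nonzero, A is a product of two shears, a dilation of the first
    coordinate and a block matrix carrying the Schur complement; otherwise a
    shear that adds a row to the first one produces a nonzero pivot. *)
Lemma scales_mulmx n (A : 'M[R]_n) : A \in unitmx ->
  scales (fun x => x *m A) `|\det A|^-1.
Proof.
elim: n A => [|n ih] A uA.
  rewrite det_mx00 normr1 invr1.
  have -> : (fun x : 'rV[R]_0 => x *m A) = (fun x => x + 0).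
    by apply/funext => x; rewrite [LHS]thinmx0 [RHS]thinmx0.
  exact: scales_translation.
have pivot (B : 'M[R]_(1 + n)) : B \in unitmx -> B 0 0 != 0 ->
    scales (fun x => x *m B) `|\det B|^-1.
  set a := B 0 0 => uB a0.
  pose r := a^-1 *: ursubmx B; pose c := a^-1 *: dlsubmx B.
  pose S := drsubmx B - c *m ursubmx B.
  pose L : 'M[R]_(1 + n) := block_mx (1%:M : 'M[R]_1) 0 c 1%:M.
  pose D1 : 'M[R]_(1 + n) := block_mx (a%:M : 'M[R]_1) 0 0 1%:M.
  pose D2 : 'M[R]_(1 + n) := block_mx (1%:M : 'M[R]_1) 0 0 S.
  pose U : 'M[R]_(1 + n) := block_mx (1%:M : 'M[R]_1) r 0 1%:M.
  have BE : B = L *m D1 *m D2 *m U.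
    rewrite /L /D1 /D2 /U !mulmx_block.
    rewrite !(mul1mx, mulmx1, mul0mx, mulmx0, add0r, addr0).
    rewrite -[LHS](submxK B); congr block_mx.
    - by rewrite [ulsubmx B]mx11_scalar; congr _%:M; rewrite !mxE !lshift0.
    - by rewrite mul_scalar_mx /r scalerA mulfV// scale1r.
    - by rewrite mul_mx_scalar /c scalerA mulfV// scale1r.
    - rewrite mul_mx_scalar {1}/c scalerA mulfV// scale1r /r /S /c.
      by rewrite -scalemxAr scalemxAl addrC subrK.
  have detB : \det B = a * \det S.
    rewrite BE !det_mulmx /L /D1 /D2 /U !(det_lblock, det_ublock).
    by rewrite !det1 det_scalar1 !mulr1 !mul1r.
  have uS : S \in unitmx.
    by move: uB; rewrite !unitmxE detB unitrM => /andP[].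
  have -> : (fun x : 'rV[R]_(1 + n) => x *m B) = (fun x => x *m U) \o ((fun x => x *m D2) \o
     ((fun x => x *m D1) \o (fun x => x *m L))).
    by apply/funext => x /=; rewrite BE !mulmxA.
  rewrite detB normrM invfM.
  rewrite -[_ / _]mul1r; apply: scales_comp; last exact: scales_shear_tail.
  rewrite mulrC; apply: scales_comp; last exact/scales_block/ih.
  rewrite -[_^-1]mulr1; apply: scales_comp; last exact: scales_dilation.
  exact: scales_shear_head.
have [a0|] := eqVneq (A 0 0) 0; last exact: pivot.
have [i ci] : exists i : 'I_n, A (lift ord0 i) 0 != 0.
  apply: contrapT => /forallNP h.
  move: uA; rewrite unitmxE (expand_det_col A 0) big1 ?unitr0// => i _.
  case: (unliftP ord0 i) => [j ->|->]; last by rewrite a0 mul0r.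
  by have /negP := h j; rewrite negbK => /eqP ->; rewrite mul0r.
(* left multiplication by P adds row i + 1 to row 0; Q is its inverse *)
pose P : 'M[R]_(1 + n) := block_mx (1%:M : 'M[R]_1) (delta_mx 0 i) 0 1%:M.
pose Q : 'M[R]_(1 + n) := block_mx (1%:M : 'M[R]_1) (- delta_mx 0 i) 0 1%:M.
have QP : Q *m P = 1%:M.
  rewrite /Q /P mulmx_block !(mul1mx, mulmx1, mul0mx, mulmx0, add0r, addr0) subrr.
  by rewrite -scalar_mx_block.
have detP : \det P = 1 by rewrite /P (det_ublock 1%:M) !det1 mulr1.
have -> : (fun x : 'rV[R]_(1 + n) => x *m A) = (fun x => x *m (P *m A)) \o (fun x => x *m Q).
  by apply/funext => x /=; rewrite -mulmxA (mulmxA Q) QP mul1mx.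
have -> : \det A = \det (P *m A) by rewrite det_mulmx detP mul1r.
rewrite -[_^-1]mulr1; apply: scales_comp; first exact: scales_shear_tail.
apply: pivot.
  by rewrite unitmx_mul uA andbT unitmxE detP unitr1.
have P0 k : P 0 (lift ord0 k) = (k == i)%:R.
  have -> : P 0 (lift ord0 k) = P (lshift n (0 : 'I_1)) (rshift 1 k).
    by congr (P _ _); exact/val_inj.
  by rewrite block_mxEur mxE eqxx.
rewrite mxE (bigD1 (0 : 'I_(1 + n)))//= a0 mulr0 add0r.
rewrite (bigD1 (lift ord0 i))//= big1 ?addr0; first by rewrite P0 eqxx mul1r.
move=> j /andP[j0 ji].
case: (unliftP ord0 j) j0 ji => [k -> _|->]; last by rewrite eqxx.
by rewrite (inj_eq (@lift_inj _ ord0)) P0 => /negbTE ->; rewrite mul0r.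
Qed.

Lemma scales_affine n (A : 'M[R]_n) b : A \in unitmx ->
  scales (fun x => b + x *m A) `|\det A|^-1.
Proof.
move=> uA; have -> : (fun x : 'rV[R]_n => b + x *m A) = (fun x => x + b) \o (fun x => x *m A).
  by apply/funext => x /=; rewrite addrC.
rewrite -[_^-1]mul1r; apply: scales_comp; first exact: scales_mulmx.
exact: scales_translation.
Qed.

End linear_change_of_variables.

(** * Integrals of row vectors *)

Section lebesgue_rV_integral.
Context {R : realType}.
Local Notation leb := (@lebesgue_measure R).
Local Notation mu := (@lebesgue_rV R).

Lemma lebesgue_rV_box n (c : 'rV[R]_n) (r : R) : 0 < r ->
  mu n (box c r) = ((r *+ 2) ^+ n)%:E.
Proof.
move=> r0; elim: n c => [|n ih] c.
  by rewrite expr0 /= diracE mem_set// => -[].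
have [c0 [c1 ->]] := rV_consP c.
rewrite lebesgue_rVS.
rewrite (_ : _ @^-1` _ = ball c0 r `*` box c1 r).
  rewrite product_measure1E ?ih; last 2 first.
  - exact: measurable_realfun.measurable_ball.
  - exact: measurable_box.
  rewrite exprS EFinM; congr (_ * _)%E.
  by apply: lebesgue_measure_ball; exact: ltW.
apply/seteqP; split => -[x y] /=.
  move=> h; split; first by have := h ord0; rewrite !mxE unlift_none /= /ball/= distrC.
  by move=> i; have := h (lift ord0 i); rewrite !mxE liftK /=.
move=> [xc yc] i; rewrite !mxE; case: (unliftP ord0 i) => [j _|_] /=; first exact: yc.
by move: xc; rewrite /ball/= distrC.
Qed.

Lemma lebesgue_rV_open_gt0 n (A : set 'rV[R]_n) x : open A -> A x -> (0 < mu n A)%E.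
Proof.
move=> oA Ax.
have /nbhs_ballP[e /= e0 eA] := open_nbhs_nbhs (conj oA Ax).
have : (mu n (box x e) <= mu n A)%E.
  apply: le_measure; rewrite ?inE.
  - exact: measurable_box.
  - exact: open_measurable_rV.
  move=> y /= yx; apply: eA; split => // i j.
  by rewrite (ord1 i) /ball/= distrC; exact: yx.
apply: lt_le_trans; rewrite lebesgue_rV_box// lte_fin exprn_gt0//.
by rewrite pmulrn_lgt0.
Qed.

Lemma lebesgue_rV_bounded_lty n (A : set 'rV[R]_n) (B : R) : measurable A ->
  (forall x, A x -> forall i, `|x ord0 i| <= B) -> (mu n A < +oo)%E.
Proof.
move=> mA AB.
have : (mu n A <= mu n (box 0 (`|B| + 1)%R))%E.
  apply: le_measure; rewrite ?inE //; first exact: measurable_box.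
  move=> y /= Ay i; rewrite mxE subr0 (le_lt_trans (AB _ Ay i))//.
  by rewrite (le_lt_trans (ler_norm B))// ltrDl.
by move/le_lt_trans; apply; rewrite lebesgue_rV_box ?ltry.
Qed.

Lemma scales_ge0_integral n (phi : 'rV[R]_n -> 'rV[R]_n) k (g : 'rV[R]_n -> \bar R) :
  scales phi k -> measurable_fun setT g -> (forall x, 0 <= g x)%E ->
  (\int[mu n]_x g (phi x) = k%:E * \int[mu n]_x g x)%E.
Proof.
move=> [k0 mphi phik] mg g0.
have -> : (\int[mu n]_x g (phi x) = \int[image_measure (mu n) mphi]_x g x)%E.
  by rewrite ge0_integral_pushforward//; apply: in1W.
rewrite -[k]/((NngNum k0)%:num) -ge0_integral_mscale//.
by apply: eq_measure_integral => A mA _; rewrite /= /mscale/= -phik.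
Qed.

Lemma scales_integrable n (phi : 'rV[R]_n -> 'rV[R]_n) k (g : 'rV[R]_n -> \bar R) :
  scales phi k -> (mu n).-integrable setT g ->
  (mu n).-integrable setT (g \o phi).
Proof.
move=> phik /integrableP[mg goo]; have [k0 mphi _] := phik.
apply/integrableP; split; first exact: measurableT_comp.
have := scales_ge0_integral phik (measurableT_comp (@abse_measurable _ _ ) mg) (fun x => abse_ge0 (g x)).
by move=> /= ->; rewrite lte_mul_pinfty.
Qed.

Lemma scales_Rintegral n (phi : 'rV[R]_n -> 'rV[R]_n) k (g : 'rV[R]_n -> R) :
  scales phi k -> (mu n).-integrable setT (EFin \o g) ->
  \int[mu n]_x g (phi x) = k * \int[mu n]_x g x.
Proof.
move=> phik ig; have mg := measurable_int _ ig.
have [k0 _ _] := phik.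
have gp := scales_ge0_integral phik (measurable_funepos mg) (funepos_ge0 _).
have gn := scales_ge0_integral phik (measurable_funeneg mg) (funeneg_ge0 _).
have fp := integral_funepos_lt_pinfty measurableT ig.
have fn := integral_funeneg_lt_pinfty measurableT ig.
rewrite /Rintegral integralE.
transitivity (fine (\int[mu n]_x (EFin \o g)^\+ (phi x) -
                    \int[mu n]_x (EFin \o g)^\- (phi x))%E).
  congr (fine (_ - _)%E); apply: eq_integral => x _.
    by rewrite !funeposE.
  by rewrite !funenegE.
rewrite gp gn.
rewrite [in RHS]integralE -(fineK (x := (\int[mu n]_x (EFin \o g)^\+ x)%E)); last first.
  by rewrite ge0_fin_numE// integral_ge0.
rewrite -(fineK (x := (\int[mu n]_x (EFin \o g)^\- x)%E)); last first.
  by rewrite ge0_fin_numE// integral_ge0.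
by rewrite -!EFinM -!EFinB /= mulrBr.
Qed.

Lemma ge0_integral_rV_cons n (a : R -> R) (b : 'rV[R]_n -> R) :
  measurable_fun setT a -> (forall x, 0 <= a x) ->
  measurable_fun setT b -> (forall x, 0 <= b x) ->
  (\int[mu n.+1]_z (a (rV_uncons z).1 * b (rV_uncons z).2)%:E =
   \int[leb]_x (a x)%:E * \int[mu n]_y (b y)%:E)%E.
Proof.
move=> ma a0 mb b0.
pose h := fun z : 'rV[R]_n.+1 => (a (rV_uncons z).1 * b (rV_uncons z).2)%:E.
have mh : measurable_fun setT h.
  apply/measurable_EFinP; apply: measurable_funM.
    apply: (measurableT_comp ma); apply: measurableT_comp => //.
    exact: measurable_rV_uncons.
  apply: (measurableT_comp mb); apply: measurableT_comp => //.
  exact: measurable_rV_uncons.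
transitivity (\int[image_measure (leb \x mu n)%E (@measurable_rV_cons R n)]_z h z)%E.
  by apply: eq_measure_integral.
rewrite ge0_integral_pushforward//; last first.
  by move=> z _; rewrite lee_fin mulr_ge0.
  exact: measurable_rV_cons.
rewrite preimage_setT.
transitivity (\int[leb \x mu n]_z (a z.1 * b z.2)%:E)%E.
  by apply: eq_integral => z _; rewrite /h /comp rV_consK.
etransitivity; first apply: fubini_tonelli1.
- apply/measurable_EFinP; apply: measurable_funM.
    by apply: (measurableT_comp ma); exact: measurable_fst.
  by apply: (measurableT_comp mb); exact: measurable_snd.
- by move=> z; rewrite lee_fin mulr_ge0.
rewrite /fubini_F /= -ge0_integralZr//; last 3 first.
- exact/measurable_EFinP.
- by move=> x _; rewrite lee_fin.
- by apply: integral_ge0 => x _; rewrite lee_fin.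
apply: eq_integral => x _; under eq_integral do rewrite EFinM.
rewrite ge0_integralZl//.
- exact/measurable_EFinP.
- by move=> y _; rewrite lee_fin.
- by rewrite lee_fin.
Qed.

(** Integrals of a product a(t) b(s) when a is a probability density: only the
    integral of b is left. This is where the profile of a boundary layer is
    integrated out. *)
Lemma Rintegral_rV_cons n (a : R -> R) (b : 'rV[R]_n -> R) :
  measurable_fun setT a -> (forall x, 0 <= a x) ->
  (\int[leb]_x (a x)%:E = 1)%E -> (mu n).-integrable setT (EFin \o b) ->
  (mu n.+1).-integrable setT
    (EFin \o (fun z => a (rV_uncons z).1 * b (rV_uncons z).2)) /\
  \int[mu n.+1]_z (a (rV_uncons z).1 * b (rV_uncons z).2) = \int[mu n]_y b y.
Proof.
move=> ma a0 a1 ib; have mb : measurable_fun setT b.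
  by apply/measurable_EFinP; exact: measurable_int ib.
have mz (c : 'rV[R]_n -> R) : measurable_fun setT c -> measurable_fun setT
    (EFin \o (fun z : 'rV[R]_n.+1 => a (rV_uncons z).1 * c (rV_uncons z).2)).
  move=> mc; apply/measurable_EFinP; apply: measurable_funM.
    apply: (measurableT_comp ma); apply: measurableT_comp => //.
    exact: measurable_rV_uncons.
  apply: (measurableT_comp mc); apply: measurableT_comp => //.
  exact: measurable_rV_uncons.
split.
  apply/integrableP; split; first exact: mz.
  have /integrableP[_] := ib; rewrite -[X in (X < _)%E -> _]mul1e -a1.
  rewrite -(@ge0_integral_rV_cons _ _ (fun y => `|b y|))//.
  - apply: le_lt_trans; rewrite le_eqVlt; apply/orP; left; apply/eqP.
    by apply: eq_integral => z _ /=; rewrite normrM ger0_norm.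
  - exact: measurableT_comp.
rewrite /Rintegral; congr fine; rewrite integralE [RHS]integralE.
have mp : measurable_fun setT (fun y => Num.max (b y) 0) by exact: measurable_maxr.
have mn : measurable_fun setT (fun y => Num.max (- b y) 0).
  by apply: measurable_maxr => //; exact: measurableT_comp.
have bp := ge0_integral_rV_cons ma a0 mp (fun y => ltac:(by rewrite le_max lexx orbT)).
have bn := ge0_integral_rV_cons ma a0 mn (fun y => ltac:(by rewrite le_max lexx orbT)).
rewrite a1 mul1e in bp; rewrite a1 mul1e in bn.
congr (_ - _)%E.
- transitivity (\int[mu n]_y (Num.max (b y) 0)%:E)%E.
    rewrite -bp; apply: eq_integral => z _.
    by rewrite funeposE -EFin_max maxr_pMr// mulr0.
  by apply: eq_integral => y _; rewrite funeposE EFin_max.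
- transitivity (\int[mu n]_y (Num.max (- b y) 0)%:E)%E.
    rewrite -bn; apply: eq_integral => z _.
    by rewrite funenegE -EFinN -EFin_max maxr_pMr// mulr0 mulrN.
  by apply: eq_integral => y _; rewrite funenegE EFin_max.
Qed.

End lebesgue_rV_integral.

(** * One-dimensional cut-off functions *)

Section cutoff.
Context {R : realType}.
Implicit Types t : R.

(** The C^1 building block: its second derivative is a step function. *)
Definition posq t : R := Num.max t 0 ^+ 2.

Lemma posq_bound t h : `|posq (h + t) - posq t - h * (2 * Num.max t 0)| <= h ^+ 2.
Proof.
rewrite /posq /Num.max; case: ifPn; rewrite -?leNgt => h1; case: ifPn; rewrite -?leNgt => h2;
  rewrite ler_norml; apply/andP; split; nra.
Qed.

(** A quadratic error bound gives differentiability without any case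
    distinction at the points where the second derivative jumps. *)
Lemma is_derive_quadratic_error (f : R -> R) t l :
  (forall h, `|f (h + t) - f t - h * l| <= h ^+ 2) -> is_derive t (1 : R) f l.
Proof.
move=> fl.
have cv : h^-1 *: (f (h *: (1 : R) + t) - f t) @[h --> 0^'] --> l.
  apply/cvgrPdist_le => e e0; near=> h.
  have h0 : h != 0 by near: h; exact: nbhs_dnbhs_neq.
  rewrite /GRing.scale /= mulr1.
  have -> : l - h^-1 * (f (h + t) - f t) = - (h^-1 * (f (h + t) - f t - h * l)) by field.
  rewrite normrN normrM normfV ler_pdivrMl ?normr_gt0//.
  apply: le_trans (fl h) _; rewrite -real_normK ?num_real// expr2 ler_wpM2l//.
  near: h; apply: dnbhs0_le; exact: e0.
by apply: DeriveDef; [apply/cvg_ex; exists l|exact/cvg_lim].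
Unshelve. all: by end_near. Qed.

(** A C^1 step equal to 0 for t <= 1 and to 1 for t >= 2; its derivative is the
    tent with apex at 3/2 and height 2. It vanishes on a neighbourhood of the
    half-line t <= 0, which makes the cut-off of a cell compactly supported in
    the open cell. *)
Definition cutoff t : R := 2 * posq (t - 1) - 4 * posq (t - 3 / 2) + 2 * posq (t - 2).

Definition dcutoff t : R :=
  4 * Num.max (t - 1) 0 - 8 * Num.max (t - 3 / 2) 0 + 4 * Num.max (t - 2) 0.

Lemma is_derive_cutoff t : is_derive t (1 : R) cutoff (dcutoff t).
Proof.
have H c : is_derive t (1 : R) (fun s => posq (s - c)) (2 * Num.max (t - c) 0).
  apply: is_derive_quadratic_error => h.
  by have := posq_bound (t - c) h; rewrite addrA.
have -> : cutoff = 2 \*: (fun s => posq (s - 1)) - 4 \*: (fun s => posq (s - 3 / 2))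
   + 2 \*: (fun s => posq (s - 2)) by [].
apply: is_derive_eq; rewrite /dcutoff /GRing.scale /=; ring.
Qed.

Lemma cutoff_le1 t : t <= 1 -> cutoff t = 0.
Proof.
move=> t1; rewrite /cutoff /posq !max_r; [ring|lra|lra|lra].
Qed.

Lemma cutoff_ge2 t : 2 <= t -> cutoff t = 1.
Proof. by move=> t2; rewrite /cutoff /posq !max_l; [field|lra|lra|lra]. Qed.

Lemma cutoff_ge0_le1 t : 0 <= cutoff t <= 1.
Proof.
rewrite /cutoff /posq /Num.max.
case: ifPn; rewrite -?leNgt => h1; case: ifPn; rewrite -?leNgt => h2;
case: ifPn; rewrite -?leNgt => h3; apply/andP; split; nra.
Qed.

Lemma dcutoff_le1 t : t <= 1 -> dcutoff t = 0.
Proof. by move=> t1; rewrite /dcutoff !max_r; [ring|lra|lra|lra]. Qed.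

Lemma dcutoff_ge2 t : 2 <= t -> dcutoff t = 0.
Proof. by move=> t2; rewrite /dcutoff !max_l; [field|lra|lra|lra]. Qed.

Lemma dcutoff_ge0 t : 0 <= dcutoff t.
Proof.
rewrite /dcutoff /Num.max.
case: ifPn; rewrite -?leNgt => h1; case: ifPn; rewrite -?leNgt => h2;
case: ifPn; rewrite -?leNgt => h3; lra.
Qed.

Lemma continuous_max0 (c : R) : continuous (fun t : R => Num.max (t - c) 0).
Proof.
have -> : (fun t : R => Num.max (t - c) 0) = (fun t => ((t - c) + `|t - c|) * 2^-1).
  apply/funext => t; case: (leP (t - c) 0) => tc.
    by rewrite ler0_norm//; lra.
  by rewrite gtr0_norm//; lra.
move=> t; apply: cvgM; last exact: cvg_cst.
have tc : (s - c) @[s --> t] --> t - c by apply: cvgB; [exact: cvg_id|exact: cvg_cst].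
by apply: cvgD => //; exact: cvg_norm.
Qed.

Lemma continuous_cutoff : continuous cutoff.
Proof.
move=> t; apply: (@differentiable_continuous _ _ _ t cutoff).
by apply/derivable1_diffP; have [] := is_derive_cutoff t.
Qed.

Lemma continuous_dcutoff : continuous dcutoff.
Proof.
move=> t; apply: cvgD; first apply: cvgB.
all: by apply: cvgM; [exact: cvg_cst|exact: continuous_max0].
Qed.

(** The fundamental theorem of calculus on [1, 2], where the cut-off increases
    from 0 to 1. *)
Lemma integral_dcutoff : (\int[@lebesgue_measure R]_t (dcutoff t)%:E = 1)%E.
Proof.
transitivity (\int[@lebesgue_measure R]_(t in `[1%R, 2%R]) (dcutoff t)%:E)%E.
  rewrite [RHS]integral_mkcond; apply: eq_integral => t _.
  rewrite patchE; case: ifPn => //; rewrite notin_setE /= in_itv/=.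
  by move=> /negP; rewrite negb_and -!ltNge => /orP[/ltW/dcutoff_le1|/ltW/dcutoff_ge2] ->.
rewrite (@continuous_FTC2 _ _ cutoff).
- by rewrite cutoff_ge2// cutoff_le1// sube0.
- lra.
- by apply: continuous_subspaceT => t; exact: continuous_dcutoff.
- split.
  + by move=> t _; have [] := is_derive_cutoff t.
  + by apply: cvg_at_right_filter; exact: continuous_cutoff.
  + by apply: cvg_at_left_filter; exact: continuous_cutoff.
- by move=> t _; rewrite derive1E; have [_ ->] := is_derive_cutoff t.
Qed.

End cutoff.

Section directional_derivative.
Context {R : realType} {V : normedModType R}.

(** Only the restriction of lam to the line through x along v matters, and
    there it is affine. *)
Lemma is_derive_along_line (lam : V -> R) (g : R -> R) x v dl dg :
  (forall h, lam (h *: v + x) = h * dl + lam x) ->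
  is_derive (lam x) (1 : R) g dg -> is_derive x v (g \o lam) (dl * dg).
Proof.
move=> lamE [/derivable1_diffP dfg gE].
have dg' : is_derive (lam x) dl g (dl * dg).
  apply: DeriveDef; first exact: diff_derivable.
  rewrite deriveE// -gE deriveE// -[dl in LHS]mulr1.
  by rewrite -[dl * 1]/(dl *: (1 : R)) linearZ.
have E : (fun h => h^-1 *: ((g \o lam) (h *: v + x) - (g \o lam) x)) =
         (fun h => h^-1 *: (g (h *: dl + lam x) - g (lam x))).
  by apply/funext => h /=; rewrite lamE.
by case: dg' => d1 d2; apply: DeriveDef; rewrite /derivable /derive E.
Qed.

Lemma is_derive_prod (I : eqType) (s : seq I) (f : I -> V -> R) (df : I -> R) x v :
  uniq s -> (forall i, is_derive x v (f i) (df i)) ->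
  is_derive x v (fun y => \prod_(i <- s) f i y)
    (\sum_(i <- s) df i * \prod_(j <- s | j != i) f j x).
Proof.
move=> us dfi; elim: s us => [_|i s ih /= /andP[ni us]].
  rewrite big_nil (_ : (fun _ => _) = cst 1); first exact: is_derive_cst.
  by apply/funext => y; rewrite big_nil.
have -> : (fun y => \prod_(j <- i :: s) f j y) = f i * (fun y => \prod_(j <- s) f j y).
  by apply/funext => y; rewrite big_cons.
have ? := ih us; apply: is_derive_eq.
rewrite /GRing.scale /= big_cons big_cons eqxx /= addrC; congr (_ + _).
  rewrite mulrC; congr (_ * _); rewrite big_seq [RHS]big_seq_cond.
  rewrite [LHS]big_mkcond [RHS]big_mkcond; apply: eq_bigr => j _.
  case: ifPn => //= js; case: eqVneq => // ji; by rewrite -ji js in ni.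
rewrite big_distrr /= big_seq [RHS]big_seq; apply: eq_bigr => j js.
rewrite big_cons; case: eqVneq => [ij|_]; first by rewrite ij js in ni.
by rewrite mulrCA.
Qed.

End directional_derivative.

(** * Limits, scalar product and barycentric coordinates *)

Section big_limits.
Context {R : realType} {T : Type} (F : set_system T) {FF : Filter F}.

Lemma cvg_sumr (I : Type) (s : seq I) (P : pred I) (f : I -> T -> R) (l : I -> R) :
  (forall i, P i -> f i x @[x --> F] --> l i) ->
  \sum_(i <- s | P i) f i x @[x --> F] --> \sum_(i <- s | P i) l i.
Proof.
move=> fl; elim: s => [|i s ih].
  by rewrite big_nil; under eq_fun do rewrite big_nil; exact: cvg_cst.
rewrite big_cons; under eq_fun do rewrite big_cons.
by case: ifPn => // Pi; apply: cvgD => //; exact: fl.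
Qed.

Lemma cvg_prodr (I : Type) (s : seq I) (P : pred I) (f : I -> T -> R) (l : I -> R) :
  (forall i, P i -> f i x @[x --> F] --> l i) ->
  \prod_(i <- s | P i) f i x @[x --> F] --> \prod_(i <- s | P i) l i.
Proof.
move=> fl; elim: s => [|i s ih].
  by rewrite big_nil; under eq_fun do rewrite big_nil; exact: cvg_cst.
rewrite big_cons; under eq_fun do rewrite big_cons.
by case: ifPn => // Pi; apply: cvgM => //; exact: fl.
Qed.

End big_limits.

Section dotp_theory.
Context {R : realType} {d : nat}.
Implicit Types x y z : 'rV[R]_d.

Lemma dotpC x y : dotp x y = dotp y x.
Proof. by apply: eq_bigr => i _; rewrite mulrC. Qed.

Lemma dotpDr x y z : dotp x (y + z) = dotp x y + dotp x z.
Proof. by rewrite -big_split; apply: eq_bigr => i _; rewrite mxE mulrDr. Qed.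

Lemma dotpZr x a y : dotp x (a *: y) = a * dotp x y.
Proof. by rewrite mulr_sumr; apply: eq_bigr => i _; rewrite mxE mulrCA. Qed.

Lemma dotpNr x y : dotp x (- y) = - dotp x y.
Proof. by rewrite -scaleN1r dotpZr mulN1r. Qed.

Lemma dotpBr x y z : dotp x (y - z) = dotp x y - dotp x z.
Proof. by rewrite dotpDr dotpNr. Qed.

Lemma dotp0r x : dotp x 0 = 0.
Proof. by rewrite -(scale0r 0) dotpZr mul0r. Qed.

Lemma dotpDl x y z : dotp (y + z) x = dotp y x + dotp z x.
Proof. by rewrite dotpC dotpDr !(dotpC x). Qed.

Lemma dotpZl x a y : dotp (a *: y) x = a * dotp y x.
Proof. by rewrite dotpC dotpZr (dotpC x). Qed.

Lemma dotpNl x y : dotp (- y) x = - dotp y x.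
Proof. by rewrite dotpC dotpNr (dotpC x). Qed.

Lemma dotp0l x : dotp 0 x = 0.
Proof. by rewrite dotpC dotp0r. Qed.

Lemma dotp_sumr I (s : seq I) (P : pred I) x (f : I -> 'rV[R]_d) :
  dotp x (\sum_(i <- s | P i) f i) = \sum_(i <- s | P i) dotp x (f i).
Proof.
apply: (big_morph (dotp x)); last exact: dotp0r.
by move=> y z; rewrite dotpDr.
Qed.

Lemma dotp_delta x i : dotp x (delta_mx ord0 i) = x ord0 i.
Proof.
rewrite /dotp (bigD1 i)//= big1 ?addr0 => [|j ji]; first by rewrite mxE !eqxx mulr1.
by rewrite mxE eqxx /= (negbTE ji) mulr0.
Qed.

Lemma dotp_ge0 x : 0 <= dotp x x.
Proof. by apply: sumr_ge0 => i _; rewrite -expr2 sqr_ge0. Qed.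

Lemma dotp_eq0 x : (dotp x x == 0) = (x == 0).
Proof.
apply/eqP/eqP => [x0|->]; last exact: dotp0r.
apply/rowP => i; rewrite mxE; apply/eqP; rewrite -sqrf_eq0.
rewrite expr2; move/eqP: x0; rewrite /dotp psumr_eq0 => [|j _]; last first.
  by rewrite -expr2 sqr_ge0.
by move=> /allP/(_ i (mem_index_enum i)).
Qed.

Lemma continuous_dotp x : continuous (dotp x).
Proof.
move=> y; apply: (@cvg_sumr _ _ (nbhs y)) => i _.
by apply: cvgM; [exact: cvg_cst|exact: coord_continuous].
Qed.

End dotp_theory.

Lemma osimplex_csimplex {R : realType} {d : nat} (m : mesh R d) (S : {set node m}) x :
  osimplex S x -> csimplex S x.
Proof. by case=> a [a0 a1 ->]; exists a; split => // v /a0/ltW. Qed.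

Section barycentric.
Context {R : realType} {n : nat}.
Variable m : mesh R n.+1.
Implicit Types (T S F : {set node m}) (u v w : node m) (x y : 'rV[R]_n.+1).

(** An affine function for each vertex, given by its gradient lam.1 v and its
    constant term lam.2 v, so that its directional derivatives are explicit. *)
Definition bary (lam : (node m -> 'rV[R]_n.+1) * (node m -> R)) v x : R :=
  lam.2 v + dotp (lam.1 v) x.

Definition is_bary T lam :=
  [/\ forall u v, u \in T -> v \in T -> bary lam v (pos u) = (u == v)%:R,
      forall x, \sum_(v in T) bary lam v x = 1 &
      forall x, \sum_(v in T) bary lam v x *: pos v = x].

(** The barycentric coordinates are the columns of the inverse of the matrix
    with rows (1, pos v), which is invertible because the vertices are affinely
    free. *)
Lemma is_bary_exists T : #|T| = n.+2 -> affine_free T -> exists lam, is_bary T lam.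
Proof.
move=> cT fT.
have /card_gt0P[v0 _] : (0 < #|T|)%N by rewrite cT.
(* e and r are inverse bijections between row indices and vertices *)
pose e (j : 'I_(1 + n.+1)) := nth v0 (enum T) j.
have sT : size (enum T) = n.+2 by rewrite -cardE.
have eT j : e j \in T by rewrite -mem_enum mem_nth// sT.
pose r v : 'I_(1 + n.+1) := inord (index v (enum T)).
have er v : v \in T -> e (r v) = v.
  move=> vT; rewrite /e /r inordK ?nth_index ?mem_enum//.
  by rewrite -sT index_mem mem_enum.
have re j : r (e j) = j.
  by apply: val_inj; rewrite /r /e index_uniq ?enum_uniq ?sT// inord_val.
have sumE (V : nmodType) (h : node m -> V) : \sum_(v in T) h v = \sum_j h (e j).
  rewrite (reindex_onto e r) /=; last by move=> v /er.
  by apply: eq_bigl => j; rewrite eT re eqxx.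
pose B : 'M[R]_(1 + n.+1) := \matrix_j row_mx (1%:M : 'M[R]_1) (pos (e j)).
have BE (a : 'rV[R]_(1 + n.+1)) : a *m B =
    row_mx ((\sum_j a ord0 j)%:M : 'M[R]_1) (\sum_j a ord0 j *: pos (e j)).
  rewrite mulmx_sum_row; under eq_bigr do rewrite rowK scale_row_mx scale_scalar_mx mulr1.
  elim/big_ind3 : _ => //=; first by rewrite raddf0 row_mx0.
  by move=> a1 b1 c1 a2 b2 c2 -> -> ; rewrite add_row_mx raddfD.
have uB : B \in unitmx.
  rewrite -row_free_unit; apply: inj_row_free => a.
  rewrite BE -[0 in RHS]row_mx0 => /eq_row_mx[/matrixP/(_ 0 0) + p0].
  rewrite !mxE eqxx mulr1n => s0.
  apply/rowP => j; rewrite mxE -(re j).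
  apply: (fT (fun v => a ord0 (r v))) (eT j).
    by rewrite sumE -[RHS]s0; apply: eq_bigr => i _; rewrite re.
  by rewrite sumE -[RHS]p0; apply: eq_bigr => i _; rewrite re.
pose D := invmx B.
pose h x : 'rV[R]_(1 + n.+1) := row_mx (1%:M : 'M[R]_1) x.
pose lam : (node m -> 'rV[R]_n.+1) * (node m -> R) :=
  (fun v => \row_k D (rshift 1 k) (r v), fun v => D (lshift n.+1 ord0) (r v)).
have lamE v x : bary lam v x = (h x *m D) ord0 (r v).
  rewrite mxE big_split_ord big_ord1 /= row_mxEl mxE mul1r; congr (_ + _).
  by apply: eq_bigr => k _; rewrite row_mxEr !mxE mulrC.
have hD x : h x *m D *m B = h x by rewrite mulmxKV.
exists lam; split.
- move=> u v uT vT; rewrite lamE -(er u uT) -(er v vT) !re.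
  have -> : h (pos (e (r u))) = row (r u) B by rewrite rowK.
  rewrite -row_mul mulmxV// mxE mxE; congr (_%:R); congr nat_of_bool.
  by apply/eqP/eqP => [->//|/(congr1 r)]; rewrite !re.
- move=> x; have := hD x; rewrite BE => /eq_row_mx[/matrixP/(_ 0 0) + _].
  by rewrite !mxE !mulr1n sumE => <-; apply: eq_bigr => j _; rewrite lamE re.
- move=> x; have := hD x; rewrite BE => /eq_row_mx[_ ].
  by move=> hx; rewrite sumE -[RHS]hx; apply: eq_bigr => j _; rewrite lamE re.
Qed.

Lemma bary_line lam v x h y : bary lam v (h *: y + x) = h * dotp (lam.1 v) y + bary lam v x.
Proof. by rewrite /bary dotpDr dotpZr; ring. Qed.

Lemma bary_sub lam v x y : bary lam v x - bary lam v y = dotp (lam.1 v) (x - y).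
Proof. by rewrite /bary dotpBr; ring. Qed.

Lemma continuous_bary lam v : continuous (bary lam v).
Proof.
move=> x; have : (lam.2 v + dotp (lam.1 v) y) @[y --> x] --> bary lam v x.
  by apply: (@cvgD _ _ _ (nbhs x)); [exact: cvg_cst|exact: continuous_dotp].
by [].
Qed.

Lemma bary_sum lam v S (a : node m -> R) : \sum_(u in S) a u = 1 ->
  bary lam v (\sum_(u in S) a u *: pos u) = \sum_(u in S) a u * bary lam v (pos u).
Proof.
move=> a1; rewrite /bary dotp_sumr.
under [RHS]eq_bigr do rewrite mulrDr.
by rewrite big_split /= -mulr_suml a1 mul1r; congr (_ + _); apply: eq_bigr => u _; rewrite dotpZr.
Qed.

Section fixed_cell.
Variables (T : {set node m}) (lam : (node m -> 'rV[R]_n.+1) * (node m -> R)).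
Hypothesis Tlam : is_bary T lam.

(** An affine function commutes with affine combinations, and its values at the
    vertices are 0 or 1. *)
Lemma bary_unique S (a : node m -> R) v : S \subset T -> v \in T ->
  \sum_(u in S) a u = 1 ->
  bary lam v (\sum_(u in S) a u *: pos u) = if v \in S then a v else 0.
Proof.
move=> /fintype.subsetP ST vT a1; have [Tuv _ _] := Tlam.
rewrite bary_sum//; case: ifPn => vS.
  rewrite (bigD1 v)//= Tuv// eqxx mulr1 big1 ?addr0// => u /andP[uS uv].
  by rewrite Tuv ?ST// (negbTE uv) mulr0.
rewrite big1// => u uS; rewrite Tuv ?(ST u uS)//.
by case: eqVneq => [uv|_]; rewrite ?mulr0//; move: vS; rewrite -uv uS.
Qed.

Let sum_sub S x (V : lmodType R) (h : node m -> V) : S \subset T ->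
  (forall v, v \in T -> v \notin S -> bary lam v x = 0) ->
  \sum_(v in T) bary lam v x *: h v = \sum_(v in S) bary lam v x *: h v.
Proof.
move=> ST x0; rewrite (big_setID S)/= [X in _ + X]big1 ?addr0.
  by apply: eq_bigl => v; rewrite inE andb_idl// => vS; exact: (fintype.subsetP ST).
by move=> v; rewrite inE => /andP[vS vT]; rewrite x0// scale0r.
Qed.

(** For a subset S of T the coordinates with respect to T decide membership in
    the face spanned by S; faces of a cell are thus compared in one system of
    coordinates. *)
Lemma csimplexP S x : S \subset T -> csimplex S x <->
  (forall v, v \in T -> 0 <= bary lam v x) /\
  (forall v, v \in T -> v \notin S -> bary lam v x = 0).
Proof.
move=> ST; have [_ T1 Tx] := Tlam; split=> [[a [a0 a1 ->]]|[x0 xS]].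
  split=> v vT; rewrite bary_unique//; first by case: ifPn => // /a0.
  by move=> /negbTE ->.
exists (fun v => bary lam v x); split.
- by move=> v vS; apply: x0; exact: (fintype.subsetP ST).
- rewrite -(T1 x); have := @sum_sub S x R^o (fun=> 1) ST xS.
  under eq_bigr do rewrite /GRing.scale /= mulr1.
  by under [RHS]eq_bigr do rewrite /GRing.scale /= mulr1; move->.
- by rewrite -(@sum_sub S x _ _ ST xS) Tx.
Qed.

Lemma osimplexP S x : S \subset T -> osimplex S x <->
  (forall v, v \in S -> 0 < bary lam v x) /\
  (forall v, v \in T -> v \notin S -> bary lam v x = 0).
Proof.
move=> ST; have [_ T1 Tx] := Tlam; split=> [[a [a0 a1 ->]]|[x0 xS]].
  split=> v vT; rewrite bary_unique//; last by move=> /negbTE ->.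
    by rewrite vT; exact: a0.
  exact: (fintype.subsetP ST).
exists (fun v => bary lam v x); split.
- exact: x0.
- rewrite -(T1 x); have := @sum_sub S x R^o (fun=> 1) ST xS.
  under eq_bigr do rewrite /GRing.scale /= mulr1.
  by under [RHS]eq_bigr do rewrite /GRing.scale /= mulr1; move->.
- by rewrite -(@sum_sub S x _ _ ST xS) Tx.
Qed.

Lemma osimplex_cellP x : osimplex T x <-> forall v, v \in T -> 0 < bary lam v x.
Proof.
split=> [/(osimplexP _ (subxx T))[]//|x0]; apply/(osimplexP _ (subxx T)); split => //.
by move=> v vT /negP.
Qed.

Lemma csimplex_cellP x : csimplex T x <-> forall v, v \in T -> 0 <= bary lam v x.
Proof.
split=> [/(csimplexP _ (subxx T))[]//|x0]; apply/(csimplexP _ (subxx T)); split => //.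
by move=> v vT /negP.
Qed.

Lemma open_osimplex : open (osimplex T).
Proof.
rewrite openE => x /osimplex_cellP x0.
suff : \forall y \near x, forall v, v \in T -> 0 < bary lam v y.
  by apply: filterS => y y0; exact/osimplex_cellP.
apply: (@filter_forall _ (node m) (fun v (y : 'rV[R]_n.+1) => v \in T -> 0 < bary lam v y) (nbhs x)) => v.
have [vT|vT] := boolP (v \in T); last by apply: nearW => y.
apply: filterS (@cvgr_gt _ _ (nbhs x) _ (bary lam v) _ (@continuous_bary lam v x) _ (x0 v vT)).
by [].
Qed.

Lemma closed_core eps : closed [set x | forall v, v \in T -> eps <= bary lam v x].
Proof.
rewrite (_ : [set _ | _] = \bigcap_(v in [set v | v \in T]) (bary lam v @^-1` [set t | eps <= t])).
  apply: closed_bigI => v _; apply: closed_comp; last exact: closed_ge.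
  by move=> x _; exact: continuous_bary.
by apply/seteqP; split => x /=.
Qed.

Definition coord_bound : R := \sum_(v in T) `|pos v|.

Lemma csimplex_bounded x i : csimplex T x -> `|x ord0 i| <= coord_bound.
Proof.
move=> [a [a0 a1 ->]]; rewrite summxE; apply: le_trans (ler_norm_sum _ _ _) _.
apply: ler_sum => v vT; rewrite mxE normrM -[leRHS]mul1r ler_pM//.
  rewrite ger0_norm ?a0// -a1 (bigD1 v)//= lerDl sumr_ge0// => u /andP[uT _].
  exact: a0.
by rewrite [X in _ <= X]/Num.norm /= mx_normrE
  (le_bigmax_cond _ (fun ij => `|pos v ij.1 ij.2|) (j := (ord0, i))).
Qed.

(** Closed, and bounded because it lies in the closed cell. For eps > 0 it is
    the support of a cut-off function. *)
Lemma compact_core eps : 0 <= eps ->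
  compact [set x | forall v, v \in T -> eps <= bary lam v x].
Proof.
move=> eps0; apply: (@subclosed_compact _ _
  [set x : 'rV[R]_n.+1 | forall i, `[- coord_bound, coord_bound]%classic (x ord0 i)]).
- exact: closed_core.
- by apply: (@rV_compact _ _ (fun=> `[- coord_bound, coord_bound]%classic)) => i; exact: segment_compact.
- move=> x /= xT i; rewrite in_itv/= -ler_norml; apply: csimplex_bounded.
  by apply/csimplex_cellP => v vT; apply: le_trans (xT v vT).
Qed.

Lemma csimplexE : csimplex T = [set x | forall v, v \in T -> 0 <= bary lam v x].
Proof. by apply/seteqP; split => x /csimplex_cellP. Qed.

Lemma compact_csimplex : compact (csimplex T).
Proof. by rewrite csimplexE; exact: compact_core. Qed.

Lemma measurable_osimplex : measurable (osimplex T).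
Proof. by apply: open_measurable_rV; exact: open_osimplex. Qed.

Lemma osimplex_lty : (lebesgue_rV n.+1 (osimplex T) < +oo)%E.
Proof.
apply: (@lebesgue_rV_bounded_lty _ _ _ coord_bound); first exact: measurable_osimplex.
by move=> x /osimplex_csimplex Tx i; exact: csimplex_bounded.
Qed.

Lemma osimplex_gt0 : (0 < #|T|)%N -> (0 < lebesgue_rV n.+1 (osimplex T))%E.
Proof.
move=> T0; apply: (@lebesgue_rV_open_gt0 _ _ _ (\sum_(v in T) #|T|%:R^-1 *: pos v)).
  exact: open_osimplex.
exists (fun=> #|T|%:R^-1); split => // [v vT|]; first by rewrite invr_gt0 ltr0n.
by rewrite sumr_const -[_ *+ _]mulr_natr mulVf// pnatr_eq0 -lt0n.
Qed.

End fixed_cell.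
End barycentric.

(** * Affine frames of a cell adapted to a face *)

Section opposite_face.
Context {R : realType} {n : nat}.
Variable m : mesh R n.+1.
Variables (T : {set node m}) (lam : (node m -> 'rV[R]_n.+1) * (node m -> R)).
Hypothesis Tlam : is_bary T lam.
Hypothesis cardT : #|T| = n.+2.
Variable w : node m.
Hypothesis wT : w \in T.

Local Notation F := (T :\ w).

Lemma card_face : #|F| = n.+1.
Proof. by have := cardsD1 w T; rewrite wT cardT => -[]. Qed.

Lemma size_enum_face : size (enum F) = n.+1.
Proof. by rewrite -cardE card_face. Qed.

(* w is a default value, never reached for k <= n *)
Definition face_node k := nth w (enum F) k.

Lemma face_nodeP k : (k < n.+1)%N -> face_node k \in F.
Proof. by move=> kn; rewrite -mem_enum mem_nth// size_enum_face. Qed.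

Lemma face_nodeT k : (k < n.+1)%N -> face_node k \in T.
Proof. by move/face_nodeP; rewrite inE => /andP[]. Qed.

Lemma face_node_neq k : (k < n.+1)%N -> face_node k != w.
Proof. by move/face_nodeP; rewrite !inE => /andP[]. Qed.

Lemma face_node_eq j k : (j < n.+1)%N -> (k < n.+1)%N ->
  (face_node j == face_node k) = (j == k).
Proof. by move=> jn kn; rewrite nth_uniq ?size_enum_face ?enum_uniq. Qed.

Lemma face_vertexE k : (k < n.+1)%N -> face_vertex F k = pos (face_node k).
Proof. by move=> kn; rewrite /face_vertex (nth_map w)// size_enum_face. Qed.

(** The vertices of T other than face_node 0, which is the origin of the frame.
    The apex w comes first: the first coordinate is then transverse to the
    face. *)
Definition frame_node (i : 'I_n.+1) : node m :=
  if unlift ord0 i is Some k then face_node k.+1 else w.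

Lemma frame_nodeT i : frame_node i \in T.
Proof. by rewrite /frame_node; case: unliftP => [k _|//]; apply: face_nodeT; rewrite ltnS. Qed.

Lemma frame_node_neq0 i : face_node 0 == frame_node i = false.
Proof.
rewrite /frame_node; case: unliftP => [k _|_]; first by rewrite face_node_eq// ltnS.
exact/negbTE/face_node_neq.
Qed.

Lemma frame_node_eq i j : (frame_node i == frame_node j) = (i == j).
Proof.
rewrite /frame_node; case: unliftP => [k ->|->]; case: unliftP => [l ->|->].
- by rewrite face_node_eq ?ltnS// (inj_eq (@lift_inj _ ord0)) eqSS.
- by rewrite (negbTE (face_node_neq _)) ?ltnS.
- by rewrite eq_sym (negbTE (face_node_neq _)) ?ltnS.
- by rewrite !eqxx.
Qed.

Lemma node_cases v : v \in T -> v = face_node 0 \/ exists i, v = frame_node i.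
Proof.
move=> vT; have [->|vw] := eqVneq v w.
  by right; exists ord0; rewrite /frame_node unlift_none.
have vF : v \in enum F by rewrite mem_enum !inE vw.
have := index_mem v (enum F); rewrite vF size_enum_face.
have := nth_index w vF; rewrite -/(face_node _).
case: index => [|k]; first by left.
by move=> <- kn; right; exists (lift ord0 (Ordinal (kn : (k < n)%N))); rewrite /frame_node liftK.
Qed.

Definition frame : 'M[R]_n.+1 :=
  \matrix_i (pos (frame_node i) - pos (face_node 0)).

Definition coframe : 'M[R]_n.+1 := \matrix_i lam.1 (frame_node i).

Lemma dotp_bary u v v' : u \in T -> v \in T -> v' \in T ->
  dotp (lam.1 u) (pos v - pos v') = (v == u)%:R - (v' == u)%:R.
Proof. by have [Tuv _ _] := Tlam => uT vT v'T; rewrite -bary_sub !Tuv. Qed.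

(** The gradients of the barycentric coordinates form the dual basis of the
    edges issued from the origin of the frame. *)
Lemma mul_frame_coframe : frame *m coframe^T = 1%:M.
Proof.
apply/matrixP => i j; rewrite !mxE.
transitivity (dotp (lam.1 (frame_node j)) (pos (frame_node i) - pos (face_node 0))).
  by apply: eq_bigr => k _; rewrite !mxE mulrC.
rewrite dotp_bary ?frame_nodeT ?face_nodeT//.
by rewrite frame_node_neq0 subr0 frame_node_eq.
Qed.

Lemma frame_unit : frame \in unitmx.
Proof. by have [] := mulmx1_unit mul_frame_coframe. Qed.

Definition frame_map (z : 'rV[R]_n.+1) := pos (face_node 0) + z *m frame.

Lemma bary_frame_map z i : bary lam (frame_node i) (frame_map z) = z ord0 i.
Proof.
have [Tuv _ _] := Tlam.
rewrite /frame_map /bary dotpDr addrA -/(bary lam (frame_node i) _).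
rewrite Tuv ?frame_nodeT ?face_nodeT// frame_node_neq0 add0r.
transitivity ((z *m frame *m coframe^T) ord0 i); last first.
  by rewrite -mulmxA mul_frame_coframe mulmx1.
by rewrite mxE; apply: eq_bigr => k _; rewrite !mxE mulrC.
Qed.

Lemma bary_frame_map0 z : bary lam (face_node 0) (frame_map z) = 1 - \sum_i z ord0 i.
Proof.
have [Tuv _ _] := Tlam.
rewrite /frame_map /bary dotpDr addrA -/(bary lam (face_node 0) _).
rewrite Tuv ?face_nodeT// eqxx mulmx_sum_row dotp_sumr -sumrN; congr (_ + _).
apply: eq_bigr => i _; rewrite dotpZr rowK dotp_bary ?frame_nodeT ?face_nodeT//.
by rewrite eqxx eq_sym frame_node_neq0 sub0r mulrN1.
Qed.

Lemma face_vertex0 : face_vertex F 0 = pos (face_node 0).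
Proof. exact: face_vertexE. Qed.

Lemma row'_frame : row' ord0 frame = face_jacobian F.
Proof.
apply/matrixP => i j; rewrite !mxE /frame_node liftK.
by rewrite face_vertex0 face_vertexE ?ltnS.
Qed.

Lemma frame_map_cons t s : frame_map (rV_cons (t, s)) =
  face_vertex F 0 + s *m face_jacobian F + t *: (pos w - face_vertex F 0).
Proof.
rewrite /frame_map face_vertex0 -addrA -row'_frame; congr (_ + _).
rewrite mulmx_sum_row big_ord_recl addrC (mulmx_sum_row s); congr (_ + _).
  by rewrite rowK mxE unlift_none /frame_node unlift_none.
apply: eq_bigr => i _; rewrite mxE liftK; congr (_ *: _).
by apply/rowP => k; rewrite !mxE.
Qed.

Lemma frame_map_face s : frame_map (rV_cons (0, s)) = face_vertex F 0 + s *m face_jacobian F.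
Proof. by rewrite frame_map_cons scale0r addr0. Qed.

Lemma sum_rV_cons t (s : 'rV[R]_n) : \sum_i (rV_cons (t, s)) ord0 i = t + \sum_i s ord0 i.
Proof.
rewrite big_ord_recl mxE unlift_none; congr (_ + _).
by apply: eq_bigr => i _; rewrite mxE liftK.
Qed.

Lemma frame_map_osimplex_face s : reference_simplex s ->
  osimplex F (face_vertex F 0 + s *m face_jacobian F).
Proof.
move=> [s0 s1]; rewrite -frame_map_face; apply/(osimplexP Tlam _ (subD1set T w)); split.
  move=> v; rewrite inE inE => /andP[vw /node_cases[->|[i vi]]].
    by rewrite bary_frame_map0 sum_rV_cons add0r subr_gt0.
  move: vw; rewrite vi bary_frame_map /frame_node mxE.
  by case: unliftP => [k _ _ /=|_]; [exact: s0|rewrite eqxx].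
move=> v vT; rewrite !inE vT andbT negbK => /eqP ->.
have := bary_frame_map (rV_cons (0, s)) ord0.
by rewrite /frame_node unlift_none mxE unlift_none.
Qed.

(** J J^T is the Gram matrix M of the frame with the row and column of the apex
    deleted, so its determinant is an entry of the adjugate of M. That adjugate
    is det M times the inverse of M, and the inverse is the Gram matrix of the
    dual basis, whose entry at the apex is the squared norm of the gradient of
    the barycentric coordinate of w. *)
Lemma gram_face_jacobian : \det (face_jacobian F *m (face_jacobian F)^T) =
  \det frame ^+ 2 * dotp (lam.1 w) (lam.1 w).
Proof.
pose M := frame *m frame^T.
have MG : M *m (coframe *m coframe^T) = 1%:M.
  rewrite /M mulmxA -(mulmxA frame) [frame^T *m _](_ : _ = 1%:M) ?mulmx1 ?mul_frame_coframe//.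
  by apply: mulmx1C; rewrite -[1%:M]trmx1 -mul_frame_coframe trmx_mul trmxK.
have adjM : \adj M = \det M *: (coframe *m coframe^T).
  have := congr1 (fun A => (coframe *m coframe^T) *m A) (mul_mx_adj M).
  by rewrite mulmxA (mulmx1C MG) mul1mx mul_mx_scalar.
have := congr1 (fun A : 'M[R]_n.+1 => A ord0 ord0) adjM.
rewrite mxE /cofactor expr0 mul1r mxE => detE.
have -> : face_jacobian F *m (face_jacobian F)^T = row' ord0 (col' ord0 M).
  rewrite -row'_frame; apply/matrixP => i j; rewrite !mxE.
  by apply: eq_bigr => k _; rewrite !mxE.
rewrite detE det_mulmx det_tr -expr2; congr (_ * _).
by rewrite mxE; apply: eq_bigr => k _; rewrite !mxE /frame_node unlift_none.
Qed.

Lemma area_factor : Num.sqrt (\det (face_jacobian F *m (face_jacobian F)^T)) =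
  `|\det frame| * enorm (lam.1 w).
Proof. by rewrite gram_face_jacobian sqrtrM ?sqr_ge0// sqrtr_sqr. Qed.

(** In the basis dual to the frame the coordinates of nu are its products with
    the edges, and all the edges but the one to the apex lie in the face. *)
Lemma normal_collinear nu :
  (forall u v, u \in F -> v \in F -> dotp nu (pos u - pos v) = 0) ->
  nu = dotp nu (pos w - pos (face_node 0)) *: lam.1 w.
Proof.
move=> nuF; set c := dotp nu _.
have -> : nu = nu *m frame^T *m coframe.
  rewrite -mulmxA [frame^T *m _](_ : _ = 1%:M) ?mulmx1//.
  by apply: mulmx1C; rewrite -[1%:M]trmx1 -mul_frame_coframe trmx_mul trmxK.
have nuE : nu *m frame^T = c *: delta_mx ord0 ord0.
  apply/rowP => i; rewrite !mxE.
  transitivity (dotp nu (pos (frame_node i) - pos (face_node 0))).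
    by apply: eq_bigr => k _; rewrite !mxE.
  rewrite /frame_node; case: unliftP => [k ->|->]; last by rewrite eqxx mulr1.
  by rewrite nuF ?face_nodeP ?ltnS// mulr0.
by rewrite nuE -scalemxAl -rowE rowK /frame_node unlift_none.
Qed.

Lemma dotp_grad_apex v : v \in F -> dotp (lam.1 w) (pos w - pos v) = 1.
Proof.
rewrite !inE => /andP[vw vT].
by rewrite dotp_bary// eqxx (negbTE vw) subr0.
Qed.

Lemma grad_neq0 : lam.1 w != 0.
Proof.
apply/eqP => g0; have := dotp_grad_apex (face_nodeP (ltn0Sn n)).
by rewrite g0 dotp0l => /eqP; rewrite eq_sym oner_eq0.
Qed.

Lemma enorm_grad_gt0 : 0 < enorm (lam.1 w).
Proof. by rewrite sqrtr_gt0 lt_def dotp_ge0 andbT dotp_eq0 grad_neq0. Qed.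

Definition face_outward := - ((enorm (lam.1 w))^-1 *: lam.1 w).

Lemma face_outward_unit : dotp face_outward face_outward = 1.
Proof.
rewrite dotpNl dotpNr opprK dotpZl dotpZr mulrA -invfM -expr2 sqr_sqrtr ?dotp_ge0//.
by rewrite mulVf// dotp_eq0 grad_neq0.
Qed.

(** The barycentric coordinate of w decreases from 1 at the apex to 0 on the
    face, so its gradient points inward; the collinearity above makes the
    outward normal unique. *)
Lemma outward_normalE : outward_normal T F = face_outward.
Proof.
have g0 := enorm_grad_gt0.
apply: xget_unique => [|nu [[nu1 nuF] nuT]].
  split; first split.
  - exact: face_outward_unit.
  - move=> u v; rewrite !inE => /andP[uw uT] /andP[vw vT].
    by rewrite dotpNl dotpZl dotp_bary// (negbTE uw) (negbTE vw) subr0 mulr0 oppr0.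
  - move=> v w' vF w'T; rewrite !inE w'T andbT negbK => /eqP ->.
    by rewrite dotpNl dotpZl dotp_grad_apex// mulr1 oppr_lt0 invr_gt0.
have := normal_collinear nuF; set c := dotp nu _ => nuE.
have c0 : c < 0 by apply: nuT => //; rewrite ?face_nodeP// !inE eqxx.
have c2 : (c * enorm (lam.1 w)) ^+ 2 = 1.
  rewrite exprMn sqr_sqrtr ?dotp_ge0// -nu1 nuE dotpZl dotpZr; ring.
have : c * enorm (lam.1 w) = -1.
  move/eqP: c2; rewrite sqrf_eq1 => /orP[|] /eqP // c1.
  have : c * enorm (lam.1 w) < 0 by rewrite pmulr_llt0.
  by rewrite c1 ltr10.
by move=> c1; rewrite nuE /face_outward -scaleNr -(mulfK (lt0r_neq0 g0) c) c1 mulN1r.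
Qed.

Lemma unit_normal_pm nu : unit_normal F nu ->
  nu = outward_normal T F \/ nu = - outward_normal T F.
Proof.
move=> [nu1 nuF]; rewrite outward_normalE; have g0 := enorm_grad_gt0.
have := normal_collinear nuF; set c := dotp nu _ => nuE.
have c2 : (c * enorm (lam.1 w)) ^+ 2 = 1.
  rewrite exprMn sqr_sqrtr ?dotp_ge0// -nu1 nuE dotpZl dotpZr; ring.
move/eqP: c2; rewrite sqrf_eq1 => /orP[|] /eqP c1; [right|left].
  by rewrite nuE /face_outward opprK -(mulfK (lt0r_neq0 g0) c) c1 mul1r.
by rewrite nuE /face_outward -scaleNr -(mulfK (lt0r_neq0 g0) c) c1 mulN1r.
Qed.

Lemma unit_normal_outward : unit_normal F (outward_normal T F).
Proof.
rewrite outward_normalE; split; first exact: face_outward_unit.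
move=> u v; rewrite !inE => /andP[uw uT] /andP[vw vT].
by rewrite dotpNl dotpZl dotp_bary// (negbTE uw) (negbTE vw) subr0 mulr0 oppr0.
Qed.

Lemma face_normal_pm :
  face_normal F = outward_normal T F \/ face_normal F = - outward_normal T F.
Proof.
apply: unit_normal_pm; rewrite /face_normal; apply: (xgetI _ unit_normal_outward).
Qed.

End opposite_face.

(** * Normals of adjacent cells *)

Section adjacent_cells.
Context {R : realType} {n : nat}.
Variable m : mesh R n.+1.
Implicit Types (T F : {set node m}) (w : node m).

Definition is_cell T := #|T| = n.+2 /\ affine_free T.

Lemma sub_faceP T F : #|T| = n.+2 -> #|F| = n.+1 -> F \subset T ->
  exists2 w, w \in T & F = T :\ w.
Proof.
move=> cT cF FT.
have /cards1P[w wE] : #|T :\: F| == 1%N.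
  by rewrite cardsD (finset.setIidPr FT) cT cF subSnn.
have wTF : w \in T :\: F by rewrite wE inE.
exists w; first by move: wTF; rewrite inE => /andP[].
by rewrite -wE finset.setDDr finset.setDv finset.set0U; exact/esym/finset.setIidPr.
Qed.

(** If both apexes were on the same side of the common face, a point slightly
    off its barycentre towards w1 would lie in both cells; conformity would put
    it in the convex hull of the common vertices, although its coordinate along
    w1 is positive. *)
Lemma opposite_sides T1 T2 lam1 lam2 w1 w2 : is_cell T1 -> is_cell T2 ->
  is_bary T1 lam1 -> is_bary T2 lam2 -> T1 != T2 ->
  csimplex T1 `&` csimplex T2 = csimplex (T1 :&: T2) ->
  w1 \in T1 -> w2 \in T2 -> T1 :\ w1 = T2 :\ w2 ->
  bary lam2 w2 (pos w1) <= 0.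
Proof.
move=> [c1 f1] [c2 f2] T1l T2l T12 conf w1T w2T FE; rewrite leNgt; apply/negP => b0.
pose F := T1 :\ w1.
have cF : #|F| = n.+1 by apply: card_face.
have w1T2 : w1 \notin T2.
  apply: contra T12 => w1T2; rewrite eqEcard c1 c2 leqnn andbT.
  apply/fintype.subsetP => v vT; have [->//|vw] := eqVneq v w1.
  have : v \in T1 :\ w1 by rewrite !inE vw.
  by rewrite FE inE => /andP[].
pose L := \sum_(v in T2) `|bary lam2 v (pos w1)|.
(* The weight e of w1 is so small that the remaining weight per vertex of the
   face is e L, enough to absorb the coordinates of pos w1 with respect to T2. *)
pose e := (1 + n.+1%:R * L)^-1 : R.
have L0 : 0 <= L by apply: sumr_ge0.
have e0 : 0 < e by rewrite invr_gt0 ltr_pwDl// mulr_ge0.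
pose a v : R := if v == w1 then e else (1 - e) / n.+1%:R.
have eE : 1 - e = e * (n.+1%:R * L).
  by rewrite /e; field; rewrite gt_eqF// ltr_pwDl// mulr_ge0.
have aE : (1 - e) / n.+1%:R = e * L.
  by rewrite eE mulrCA mulrC mulKf// pnatr_eq0.
have aw v : v \in F -> a v = e * L.
  by rewrite !inE /a => /andP[/negbTE -> _].
have a0 v : v \in T1 -> 0 <= a v.
  by move=> vT; rewrite /a; case: ifPn => _; [exact: ltW|rewrite aE mulr_ge0// ltW].
have sumT1 (V : nmodType) (h : node m -> V) : \sum_(v in T1) h v = h w1 + \sum_(v in F) h v.
  rewrite (bigD1 w1)//=; congr (_ + _); apply: eq_bigl => v.
  by rewrite !inE andbC.
have a1 : \sum_(v in T1) a v = 1.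
  rewrite sumT1 (eq_bigr (fun=> e * L)) => [|v /aw//].
  rewrite sumr_const cF /a eqxx -mulr_natl.
  by rewrite mulrCA -eE addrC subrK.
pose x := \sum_(v in T1) a v *: pos v.
have xT1 : csimplex T1 x by exists a; split.
have xw1 : bary lam1 w1 x = e.
  by rewrite (bary_unique T1l)// w1T /a eqxx.
have xb v : v \in T2 -> bary lam2 v x =
    e * bary lam2 v (pos w1) + if v \in F then e * L else 0.
  move=> vT; rewrite bary_sum// sumT1 /a eqxx; congr (_ + _).
  have [T2uv _ _] := T2l.
  have FT2 u : u \in F -> u \in T2 by rewrite /F FE inE => /andP[].
  rewrite (eq_bigr (fun u => e * L * (u == v)%:R)); last first.
    by move=> u uF; rewrite -/(a u) aw// T2uv// FT2.
  case: ifPn => vF.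
    rewrite (bigD1 v)//= eqxx mulr1 big1 ?addr0// => u /andP[_ /negbTE ->].
    by rewrite mulr0.
  rewrite big1// => u uF; case: eqVneq => [uv|_]; last by rewrite mulr0.
  by rewrite -uv uF in vF.
have xT2 : csimplex T2 x.
  apply/(csimplex_cellP T2l) => v vT; rewrite xb//; case: ifPn => vF.
    rewrite -mulrDr mulr_ge0 ?(ltW e0)//.
    have : `|bary lam2 v (pos w1)| <= L.
      by rewrite /L (bigD1 v)//= lerDl sumr_ge0.
    by rewrite ler_norml => /andP[+ _]; rewrite lerNl -subr_ge0 opprK addrC.
  move: vF; rewrite /F FE !inE vT andbT negbK => /eqP ->.
  by rewrite addr0 mulr_ge0 ?ltW.
have : csimplex (T1 :&: T2) x by rewrite -conf.
move=> /(csimplexP T1l _ (subsetIl _ _))[_ /(_ w1 w1T)].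
rewrite inE w1T (negbTE w1T2) xw1 => /(_ isT) e0'.
by move: e0; rewrite e0' ltxx.
Qed.

(** The two outward normals are unit normals of one face, hence equal up to
    sign; if they were equal, the apex of T1 would be on the side of the face
    where T2 lies. *)
Lemma outward_normal_opposite T1 T2 F : is_cell T1 -> is_cell T2 -> T1 != T2 ->
  csimplex T1 `&` csimplex T2 = csimplex (T1 :&: T2) ->
  #|F| = n.+1 -> F \subset T1 -> F \subset T2 ->
  outward_normal T2 F = - outward_normal T1 F.
Proof.
move=> cell1 cell2 T12 conf cF FT1 FT2; have [[c1 f1] [c2 f2]] := (cell1, cell2).
have [lam1 T1l] := is_bary_exists c1 f1.
have [lam2 T2l] := is_bary_exists c2 f2.
have [w1 w1T F1] := sub_faceP c1 cF FT1.
have [w2 w2T F2] := sub_faceP c2 cF FT2.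
have FE : T1 :\ w1 = T2 :\ w2 by rewrite -F1 -F2.
have b0 := opposite_sides cell1 cell2 T1l T2l T12 conf w1T w2T FE.
have un1 := unit_normal_outward T1l c1 w1T.
rewrite -F1 in un1; move: (un1); rewrite {1}F2 => /(unit_normal_pm T2l c2 w2T).
rewrite -F2 => -[n12|->]; last by rewrite opprK.
suff : 0 < bary lam2 w2 (pos w1) by rewrite ltNge b0.
have v0F : face_node T2 w2 0 \in T2 :\ w2 by exact: face_nodeP.
have v0T2 : face_node T2 w2 0 \in T2 by move: v0F; rewrite inE => /andP[].
have [T2uv _ _] := T2l.
have v0w : face_node T2 w2 0 == w2 = false.
  by move: v0F; rewrite !inE => /andP[/negbTE].
rewrite -[bary _ _ _]subr0 -[0 in X in _ < X](_ : bary lam2 w2 (pos (face_node T2 w2 0)) = 0); last first.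
  by rewrite T2uv// v0w.
rewrite bary_sub.
have := outward_normalE T2l c2 w2T; rewrite -F2 -n12 => n1E.
have g0 := enorm_grad_gt0 T2l c2 w2T.
have -> : lam2.1 w2 = - (enorm (lam2.1 w2) *: outward_normal T1 F).
  by rewrite n1E /face_outward scalerN opprK scalerA mulfV ?scale1r// gt_eqF.
rewrite dotpNl dotpZl -mulrN mulr_gt0//.
rewrite F1 (outward_normalE T1l c1 w1T) dotpNl opprK dotpZl.
rewrite (dotp_grad_apex T1l) ?mulr1 ?invr_gt0 ?(enorm_grad_gt0 T1l c1 w1T)//.
by rewrite FE.
Qed.

End adjacent_cells.

(** * Concentration of cut-off gradients on faces *)

Section real_integral.
Context {d : measure_display} {T : measurableType d} {R : realType}.
Variable mu : {measure set T -> \bar R}.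
Implicit Types (D : set T) (f : T -> R).

Lemma bounded_integrable D f B : measurable D -> (mu D < +oo)%E ->
  measurable_fun D f -> (forall x, D x -> `|f x| <= B) ->
  mu.-integrable D (EFin \o f).
Proof.
move=> mD Doo mf fB; apply: measurable_bounded_integrable => //.
exists B; split; first exact: num_real.
by move=> M BM x Dx; apply: le_trans (fB x Dx) (ltW BM).
Qed.

Lemma dominated_Rintegrable D f g : measurable D -> measurable_fun D f ->
  (forall x, D x -> `|f x| <= g x) -> mu.-integrable D (EFin \o g) ->
  mu.-integrable D (EFin \o f).
Proof.
move=> mD mf fg; apply: le_integrable => //; first exact/measurable_EFinP.
by move=> x Dx /=; rewrite lee_fin (le_trans (fg x Dx))// ler_norm.
Qed.

Lemma Rintegral_sum D (I : Type) (s : seq I) (P : pred I) (h : I -> T -> R) :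
  measurable D -> (forall i, P i -> mu.-integrable D (EFin \o h i)) ->
  \int[mu]_(x in D) (\sum_(i <- s | P i) h i x) =
  \sum_(i <- s | P i) \int[mu]_(x in D) h i x.
Proof.
move=> mD ih; elim: s => [|i s IH].
  rewrite big_nil; under eq_Rintegral do rewrite big_nil.
  by rewrite Rintegral_cst// mul0r.
rewrite big_cons; under eq_Rintegral do rewrite big_cons.
case: ifPn => Pi; last exact: IH.
rewrite -IH RintegralD//; first exact: ih.
have := @integrable_sum _ _ _ mu D mD _ s P (fun i x => (h i x)%:E) ih.
by apply: eq_integrable => // x _ /=; rewrite sumEFin.
Qed.

Lemma dominated_Rintegral_cvg D (f_ : nat -> T -> R) f g : measurable D ->
  (forall k, measurable_fun D (f_ k)) ->
  (forall x, D x -> f_ k x @[k --> \oo] --> f x) ->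
  mu.-integrable D (EFin \o g) ->
  (forall k x, D x -> `|f_ k x| <= g x) ->
  \int[mu]_(x in D) f_ k x @[k --> \oo] --> \int[mu]_(x in D) f x.
Proof.
move=> mD mf_ f_f ig f_g.
have mf : measurable_fun D f by apply: (measurable_fun_cvg mf_).
have [//|||//||iff _ cv] := @dominated_convergence _ _ _ mu D mD (fun k => EFin \o f_ k)
   (EFin \o f) (EFin \o g).
- by move=> k; exact/measurable_EFinP.
- exact/measurable_EFinP.
- by apply: aeW => x Dx; apply/cvg_EFin; [exact: nearW|exact: f_f].
- by apply: aeW => x k Dx; rewrite /= lee_fin f_g.
apply: fine_cvg; rewrite fineK//.
exact: integrable_fin_num.
Qed.

Lemma Rintegral_support D E f : D `<=` E -> (forall x, E x -> ~ D x -> f x = 0) ->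
  \int[mu]_(x in E) f x = \int[mu]_(x in D) f x.
Proof.
move=> DE f0; rewrite Rintegral_mkcond [RHS]Rintegral_mkcond; congr Rintegral.
apply/funext => x; rewrite !patchE.
have [xD|xD] := boolP (x \in D).
  by rewrite mem_set//; apply: DE; exact: set_mem.
case: ifPn => // xE; apply: f0; first exact: set_mem.
by move=> Dx; rewrite mem_set in xD.
Qed.

End real_integral.

Lemma within_continuous_bounded {R : realType} n (K : set 'rV[R]_n) (u : 'rV[R]_n -> R) :
  compact K -> {within K, continuous u} ->
  exists2 B, 0 <= B & forall x, K x -> `|u x| <= B.
Proof.
move=> cK cu; have [M [_ MB]] := compact_bounded (continuous_compact cu cK).
exists (`|M| + 1) => [|x Kx]; first by rewrite addr_ge0.
apply: MB; last by exists x.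
by rewrite (le_lt_trans (ler_norm M))// ltrDl.
Qed.

Lemma cvg_rV_coord {R : realType} {n : nat} {S : Type} (G : set_system S)
    {FG : Filter G} (f : S -> 'rV[R]_n) (x : 'rV[R]_n) :
  (forall i, f k ord0 i @[k --> G] --> x ord0 i) -> f k @[k --> G] --> x.
Proof.
move=> fx P [Q Qx QP].
have : \forall k \near G, forall j, Q ord0 j (f k ord0 j).
  by apply: (@filter_forall _ _ (fun j k => Q ord0 j (f k ord0 j))) => j; exact: fx.
by apply: filterS => k fk; apply: QP => i j; rewrite (ord1 i).
Qed.

Lemma within_continuous_cvg {R : realType} {n : nat} (K : set 'rV[R]_n) (u : 'rV[R]_n -> R)
    {S : Type} (G : set_system S) {FG : Filter G} (y : S -> 'rV[R]_n) x :
  {within K, continuous u} -> K x -> (\forall k \near G, K (y k)) ->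
  y k @[k --> G] --> x -> u (y k) @[k --> G] --> u x.
Proof.
move=> /subspace_continuousP cu Kx Ky yx P /(cu x Kx) /yx.
by rewrite /= => yP; apply: filterS2 Ky yP => k Kyk; exact.
Qed.

Lemma within_continuous_comp {R : realType} {n p : nat} (A : set 'rV[R]_n)
    (K : set 'rV[R]_p) (u : 'rV[R]_p -> R) (phi : 'rV[R]_n -> 'rV[R]_p) :
  {within K, continuous u} -> continuous phi -> (forall x, A x -> K (phi x)) ->
  {within A, continuous (u \o phi)}.
Proof.
move=> cu cphi AK; apply/subspace_continuousP => x Ax.
apply: (@within_continuous_cvg _ _ K u _ (within A (nbhs x)) _ phi (phi x)) => //.
- exact: AK.
- by rewrite near_withinE; apply: filterE => y; exact: AK.
- by apply: cvg_within_filter; exact: cphi.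
Qed.

Section reference_simplex.
Context {R : realType} {n : nat}.

Lemma open_reference_simplex : open (@reference_simplex R n).
Proof.
rewrite openE => s [s0 s1].
have P0 : \forall y \near s, forall i, 0 < (y : 'rV[R]_n) ord0 i.
  apply: (@filter_forall _ _ (fun i (y : 'rV[R]_n) => 0 < y ord0 i) (nbhs s)) => i.
  exact: (@cvgr_gt _ _ (nbhs s) _ (fun y : 'rV[R]_n => y ord0 i) _
    (@coord_continuous _ _ _ ord0 i s) _ (s0 i)).
have P1 : \forall y \near s, \sum_i (y : 'rV[R]_n) ord0 i < 1.
  have cs : \sum_i (y : 'rV[R]_n) ord0 i @[y --> s] --> \sum_i s ord0 i.
    by apply: (@cvg_sumr _ _ (nbhs s)) => i _; exact: coord_continuous.
  exact: (@cvgr_lt _ _ (nbhs s) _ _ _ cs _ s1).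
by apply: filterS2 P0 P1 => y.
Qed.

Lemma measurable_reference_simplex : measurable (@reference_simplex R n).
Proof. by apply: open_measurable_rV; exact: open_reference_simplex. Qed.

Lemma reference_simplex_lty : (lebesgue_rV n (@reference_simplex R n) < +oo)%E.
Proof.
apply: (@lebesgue_rV_bounded_lty _ _ _ 1); first exact: measurable_reference_simplex.
move=> s [s0 s1] i; rewrite gtr0_norm//; apply: le_trans (ltW s1).
by rewrite (bigD1 i)//= lerDl sumr_ge0// => j _; exact: ltW.
Qed.

End reference_simplex.

Section cell_cutoff.
Context {R : realType} {n : nat}.
Variable m : mesh R n.+1.
Variables (T : {set node m}) (lam : (node m -> 'rV[R]_n.+1) * (node m -> R)).
Hypothesis Tlam : is_bary T lam.
Hypothesis cardT : #|T| = n.+2.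
Local Notation mu := (lebesgue_rV n.+1).
Implicit Types (w : node m) (x : 'rV[R]_n.+1) (dl : R).

Definition cell_cutoff dl x : R := \prod_(v in T) cutoff (bary lam v x / dl).

(** The part of the gradient of cell_cutoff dl along the gradient of the
    barycentric coordinate of w: the derivative hits the factor of w. *)
Definition layer w dl x : R :=
  dl^-1 * dcutoff (bary lam w x / dl) *
  \prod_(v in T | v != w) cutoff (bary lam v x / dl).

Lemma continuous_bary_quot v dl : continuous (fun x => bary lam v x / dl).
Proof.
move=> x; apply: (@cvgM _ _ (nbhs x)); last exact: cvg_cst.
exact: continuous_bary.
Qed.

Lemma continuous_cutoff_bary v dl : continuous (fun x => cutoff (bary lam v x / dl)).
Proof.
move=> x; apply: (@continuous_comp _ _ _ (fun y => bary lam v y / dl) cutoff).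
  exact: continuous_bary_quot.
exact: continuous_cutoff.
Qed.

Lemma continuous_cell_cutoff dl : continuous (cell_cutoff dl).
Proof.
move=> x; apply: (@cvg_prodr _ _ (nbhs x)) => v _; exact: continuous_cutoff_bary.
Qed.

Lemma continuous_layer w dl : continuous (layer w dl).
Proof.
move=> x; apply: (@cvgM _ _ (nbhs x)).
  apply: (@cvgM _ _ (nbhs x)); first exact: cvg_cst.
  apply: (@continuous_comp _ _ _ (fun y => bary lam w y / dl) dcutoff).
    exact: continuous_bary_quot.
  exact: continuous_dcutoff.
by apply: (@cvg_prodr _ _ (nbhs x)) => v _; exact: continuous_cutoff_bary.
Qed.

Lemma is_derive_cell_cutoff dl x y :
  is_derive x y (cell_cutoff dl) (\sum_(w in T) layer w dl x * dotp (lam.1 w) y).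
Proof.
have H v : is_derive x y (fun z => cutoff (bary lam v z / dl))
    (dotp (lam.1 v) y / dl * dcutoff (bary lam v x / dl)).
  apply: (@is_derive_along_line _ _ (fun z => bary lam v z / dl) cutoff).
    by move=> h; rewrite bary_line mulrDl mulrA.
  exact: is_derive_cutoff.
have := is_derive_prod (enum_uniq (mem T)) H.
rewrite (_ : (fun z => _) = cell_cutoff dl); last first.
  by apply/funext => z; rewrite big_enum.
rewrite big_enum /= (_ : \sum_(i in T) _ = \sum_(w in T) layer w dl x * dotp (lam.1 w) y)//.
apply: eq_bigr => w wT; rewrite /layer big_enum_cond /=.
ring.
Qed.

Lemma cell_cutoff_ge0_le1 dl x : 0 <= cell_cutoff dl x <= 1.
Proof.
apply/andP; split; first by apply: prodr_ge0 => v _; case/andP: (cutoff_ge0_le1 (bary lam v x / dl)).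
by apply: prodr_ile1 => v _; exact: cutoff_ge0_le1.
Qed.

Lemma cell_cutoff_outside dl x v : 0 < dl -> v \in T -> bary lam v x <= dl ->
  cell_cutoff dl x = 0.
Proof.
move=> dl0 vT xv; rewrite /cell_cutoff (bigD1 v)//= cutoff_le1 ?mul0r//.
by rewrite ler_pdivrMr// mul1r.
Qed.

Lemma layer_outside w dl x v : 0 < dl -> w \in T -> v \in T -> bary lam v x <= dl ->
  layer w dl x = 0.
Proof.
move=> dl0 wT vT xv; have xv1 : bary lam v x / dl <= 1 by rewrite ler_pdivrMr// mul1r.
rewrite /layer; have [<-|vw] := eqVneq v w.
  by rewrite dcutoff_le1// mulr0 mul0r.
by rewrite (bigD1 v) ?vT//= cutoff_le1// mul0r mulr0.
Qed.

Lemma notin_osimplex x : ~ osimplex T x -> exists2 v, v \in T & bary lam v x <= 0.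
Proof.
move=> /(osimplex_cellP Tlam) /existsNP[v /not_implyP[vT /negP]].
by rewrite -leNgt => x0; exists v.
Qed.

(** The cut-off vanishes as soon as some barycentric coordinate is at most dl,
    so its support is a compact subset of the open cell. *)
Lemma cell_cutoff_C1_c (Om : set 'rV[R]_n.+1) dl : 0 < dl -> osimplex T `<=` Om ->
  C1_c Om (cell_cutoff dl).
Proof.
move=> dl0 TOm; split.
- exists [set x | forall v, v \in T -> dl <= bary lam v x]; split.
  + exact: (compact_core Tlam (ltW dl0)).
  + move=> x /= xT; apply: TOm; apply/(osimplex_cellP Tlam) => v vT.
    exact: lt_le_trans (xT v vT).
  + move=> x /existsNP[v /not_implyP[vT /negP]]; rewrite -ltNge => /ltW.
    exact: cell_cutoff_outside.
- exact: continuous_cell_cutoff.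
- by move=> i x; have [] := is_derive_cell_cutoff dl x (delta_mx ord0 i).
- move=> i; rewrite (_ : partial i _ = fun x => \sum_(w in T) layer w dl x * lam.1 w ord0 i).
    move=> x; apply: (@cvg_sumr _ _ (nbhs x)) => w _.
    apply: (@cvgM _ _ (nbhs x)); last exact: cvg_cst.
    exact: continuous_layer.
  apply/funext => x; have [_ pE] := is_derive_cell_cutoff dl x (delta_mx ord0 i).
  by rewrite /partial pE; apply: eq_bigr => w _; rewrite dotp_delta.
Qed.

Lemma partial_cell_cutoff dl i x :
  partial i (cell_cutoff dl) x = \sum_(w in T) layer w dl x * lam.1 w ord0 i.
Proof.
have [_ pE] := is_derive_cell_cutoff dl x (delta_mx ord0 i).
by rewrite /partial pE; apply: eq_bigr => w _; rewrite dotp_delta.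
Qed.

Definition thickness k : R := k.+1%:R^-1.

Lemma thickness_gt0 k : 0 < thickness k. Proof. by rewrite invr_gt0. Qed.

Lemma thickness_cvg0 : thickness k @[k --> \oo] --> (0 : R).
Proof. exact: cvg_harmonic. Qed.

(** The thickness tends to 0, so a quantity with a positive limit is eventually
    at least twice as large. *)
Lemma near_cutoff1 (a : nat -> R) (b : R) : 0 < b -> a k @[k --> \oo] --> b ->
  \forall k \near \oo, cutoff (a k / thickness k) = 1.
Proof.
move=> b0 ab; near=> k; apply: cutoff_ge2; rewrite ler_pdivlMr ?thickness_gt0//.
apply: (@le_trans _ _ (b / 2)).
  have : thickness k <= b / 4.
    near: k; apply: (cvgr_le _ thickness_cvg0); lra.
  by move=> /=; lra.
near: k; apply: (cvgr_ge _ ab); lra.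
Unshelve. all: by end_near. Qed.

Lemma cell_cutoff_cvg1 x : osimplex T x ->
  cell_cutoff (thickness k) x @[k --> \oo] --> (1 : R).
Proof.
move=> /(osimplex_cellP Tlam) x0.
suff : \forall k \near \oo, (1 : R) = cell_cutoff (thickness k) x.
  by move=> H; apply: cvg_trans (near_eq_cvg H) _; exact: cvg_cst.
have : \forall k \near \oo, forall v, v \in T -> cutoff (bary lam v x / thickness k) = 1.
  apply: (@filter_forall _ (node m) (fun v k => v \in T -> cutoff (bary lam v x / thickness k) = 1)) => v.
  have [vT|_] := boolP (v \in T); last exact: nearW.
  by apply: filterS (near_cutoff1 (x0 v vT) (cvg_cst _)).
by apply: filterS => k xk; rewrite /cell_cutoff big1.
Qed.

(** The affine chart of the cell in which the layer of thickness dl at the face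
    opposite to w becomes a layer of unit thickness. *)
Definition layer_map w dl (z : 'rV[R]_n.+1) : 'rV[R]_n.+1 :=
  frame_map T w (z *m (block_mx (dl%:M : 'M[R]_1) 0 0 1%:M : 'M[R]_n.+1)).

Lemma layer_map_cons w dl t (s : 'rV[R]_n) :
  layer_map w dl (rV_cons (t, s)) = frame_map T w (rV_cons (t * dl, s)).
Proof.
by rewrite /layer_map rV_cons_mul_block mulmx0 mxE addr0 scaler0 add0r mulmx1.
Qed.

Lemma scales_layer_map w dl : w \in T -> 0 < dl ->
  scales (layer_map w dl) (`|\det (frame T w)|^-1 * dl^-1).
Proof.
move=> wT dl0; rewrite -[in dl^-1](gtr0_norm dl0).
apply: (scales_comp (scales_dilation n (lt0r_neq0 dl0))).
apply: scales_affine; exact: (frame_unit Tlam cardT wT).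
Qed.

Section layer_limit.
Variables (w : node m) (u : 'rV[R]_n.+1 -> R).
Hypothesis wT : w \in T.
Hypothesis cu : {within csimplex T, continuous u}.
Local Notation F := (T :\ w).
Local Notation face_map s := (face_vertex F 0 + s *m face_jacobian F).

Lemma layer_map_line dl z : layer_map w dl z =
  ((rV_uncons z).1 * dl) *: (pos w - face_vertex F 0) + face_map (rV_uncons z).2.
Proof.
rewrite -{1}(rV_unconsK z) (surjective_pairing (rV_uncons z)).
by rewrite layer_map_cons (frame_map_cons cardT wT) addrC.
Qed.

Lemma layer_map_cvg z :
  layer_map w (thickness k) z @[k --> \oo] --> face_map (rV_uncons z).2.
Proof.
have -> : (fun k => layer_map w (thickness k) z) = (fun k =>
    ((rV_uncons z).1 * thickness k) *: (pos w - face_vertex F 0) + face_map (rV_uncons z).2).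
  by apply/funext => k; exact: layer_map_line.
have tc : (rV_uncons z).1 * thickness k @[k --> \oo] --> (rV_uncons z).1 * 0.
  by apply: cvgM; [exact: cvg_cst|exact: thickness_cvg0].
apply: cvg_rV_coord => i; rewrite mulr0 in tc.
have -> : face_map (rV_uncons z).2 ord0 i =
    0 * (pos w - face_vertex F 0) ord0 i + face_map (rV_uncons z).2 ord0 i.
  by rewrite mul0r add0r.
under eq_fun do rewrite mxE [X in X + _]mxE.
by apply: cvgD; [apply: cvgM => //; exact: cvg_cst|exact: cvg_cst].
Qed.

Lemma bary_layer_map_apex dl z : bary lam w (layer_map w dl z) = (rV_uncons z).1 * dl.
Proof.
rewrite -{1}(rV_unconsK z) (surjective_pairing (rV_uncons z)) layer_map_cons.
have := bary_frame_map Tlam cardT wT (rV_cons ((rV_uncons z).1 * dl, (rV_uncons z).2)) ord0.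
by rewrite mxE unlift_none /= /frame_node unlift_none.
Qed.

Lemma layer_map_reference dl z : 0 < dl -> 0 < (rV_uncons z).1 ->
  osimplex T (layer_map w dl z) -> reference_simplex (rV_uncons z).2.
Proof.
have [t [s ->]] := rV_consP z; rewrite rV_consK => dl0 t0.
rewrite layer_map_cons => /(osimplex_cellP Tlam) sT; split => [i|].
  have := sT _ (frame_nodeT cardT wT (lift ord0 i)).
  by rewrite (bary_frame_map Tlam cardT wT) mxE liftK.
have := sT _ (face_nodeT cardT wT (ltn0Sn n)).
rewrite (bary_frame_map0 Tlam cardT wT) sum_rV_cons subr_gt0.
by apply: lt_trans; rewrite ltrDr mulr_gt0.
Qed.

Lemma face_map_closed s : reference_simplex s -> csimplex T (face_map s).
Proof.
move=> /(frame_map_osimplex_face Tlam cardT wT)/osimplex_csimplex.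
move=> /(csimplexP Tlam _ (subD1set T w))[s0 _].
exact/(csimplex_cellP Tlam).
Qed.

Lemma bary_face_map_gt0 s v : reference_simplex s -> v \in T -> v != w ->
  0 < bary lam v (face_map s).
Proof.
move=> /(frame_map_osimplex_face Tlam cardT wT)/(osimplexP Tlam _ (subD1set T w))[s0 _] vT vw.
by apply: s0; rewrite !inE vw.
Qed.

(** The layer times u, extended by zero outside the cell, in the chart of the
    layer; the factor thickness k comes from the change of variables. *)
Let layer_integrand k (z : 'rV[R]_n.+1) : R :=
  thickness k * ((fun x => layer w (thickness k) x * u x) \_ (osimplex T)) (layer_map w (thickness k) z).

Let limit_integrand (z : 'rV[R]_n.+1) : R :=
  dcutoff (rV_uncons z).1 *
  ((fun s => u (face_map s)) \_ (@reference_simplex R n)) (rV_uncons z).2.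

Let layer_integrandE k z : osimplex T (layer_map w (thickness k) z) ->
  layer_integrand k z = dcutoff (rV_uncons z).1 *
    (\prod_(v in T | v != w) cutoff (bary lam v (layer_map w (thickness k) z) / thickness k) *
     u (layer_map w (thickness k) z)).
Proof.
move=> zT; rewrite /layer_integrand patchE mem_set// /layer.
rewrite bary_layer_map_apex mulfK ?gt_eqF ?thickness_gt0//.
rewrite -!mulrA mulrA mulfV ?mul1r// gt_eqF// thickness_gt0//.
Qed.

Let layer_integrand0 k z : ~ osimplex T (layer_map w (thickness k) z) ->
  layer_integrand k z = 0.
Proof.
by move=> zT; rewrite /layer_integrand patchE memNset// mulr0.
Qed.

Let dcutoff_layer k z : dcutoff (rV_uncons z).1 = 0 -> layer_integrand k z = 0.
Proof.
move=> d0; have [zT|zT] := pselect (osimplex T (layer_map w (thickness k) z)).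
  by rewrite layer_integrandE// d0 mul0r.
exact: layer_integrand0.
Qed.

Let reference_layer k z : ~ reference_simplex (rV_uncons z).2 -> layer_integrand k z = 0.
Proof.
move=> zR; have [z1|z1] := leP (rV_uncons z).1 1.
  by apply: dcutoff_layer; rewrite dcutoff_le1.
apply: layer_integrand0; apply: contra_not zR; apply: layer_map_reference => //.
  exact: thickness_gt0.
exact: lt_trans z1.
Qed.

(** When the last coordinates of z lie in the reference simplex, layer_map z
    tends to a point of the open face. The coordinates of the vertices of the
    face stay positive, so their cut-offs are eventually 1, while the factor of
    w no longer depends on k. *)
Let layer_integrand_cvg z : layer_integrand k z @[k --> \oo] --> limit_integrand z.
Proof.
rewrite /limit_integrand patchE; have [zR|zR] := pselect (reference_simplex (rV_uncons z).2); last first.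
  rewrite memNset// mulr0; under eq_fun do rewrite reference_layer//.
  exact: cvg_cst.
rewrite mem_set//; have [z1|z1] := leP (rV_uncons z).1 1.
  have d0 : dcutoff (rV_uncons z).1 = 0 by exact: dcutoff_le1.
  by rewrite d0 mul0r; under eq_fun do rewrite dcutoff_layer//; exact: cvg_cst.
have near1 : \forall k \near \oo, forall v, v \in T -> v != w ->
    0 < bary lam v (layer_map w (thickness k) z) /\
    cutoff (bary lam v (layer_map w (thickness k) z) / thickness k) = 1.
  apply: (@filter_forall _ (node m) (fun v k => v \in T -> v != w ->
    0 < bary lam v (layer_map w (thickness k) z) /\
    cutoff (bary lam v (layer_map w (thickness k) z) / thickness k) = 1)) => v.
  have [vT|_] := boolP (v \in T); last exact: nearW.
  have [_|vw] := eqVneq v w; first exact: nearW.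
  have b0 := bary_face_map_gt0 zR vT vw.
  have bcvg : bary lam v (layer_map w (thickness k) z) @[k --> \oo] -->
      bary lam v (face_map (rV_uncons z).2).
    by apply: continuous_cvg; [exact: continuous_bary|exact: layer_map_cvg].
  by apply: filterS2 (near_cutoff1 b0 bcvg) (cvgr_gt _ bcvg _ b0).
have nearT : \forall k \near \oo, osimplex T (layer_map w (thickness k) z).
  apply: filterS near1 => k kz; apply/(osimplex_cellP Tlam) => v vT.
  have [->|vw] := eqVneq v w; last by case: (kz v vT vw).
  by rewrite bary_layer_map_apex mulr_gt0 ?thickness_gt0// (lt_trans _ z1).
have H : \forall k \near \oo,
    dcutoff (rV_uncons z).1 * u (layer_map w (thickness k) z) = layer_integrand k z.
  apply: filterS2 near1 nearT => k kz kT.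
  by rewrite layer_integrandE// big1 ?mul1r// => v /andP[vT vw]; case: (kz v vT vw).
apply: cvg_trans (near_eq_cvg H) _; apply: cvgM; first exact: cvg_cst.
apply: (@within_continuous_cvg _ _ (csimplex T) u _ \oo _ (fun k => layer_map w (thickness k) z)) => //.
- exact: face_map_closed.
- by apply: filterS nearT => k; exact: osimplex_csimplex.
- exact: layer_map_cvg.
Qed.

Let layer_integrand_bound B k z : (forall x, csimplex T x -> `|u x| <= B) -> 0 <= B ->
  `|layer_integrand k z| <=
  dcutoff (rV_uncons z).1 * ((fun=> B) \_ (@reference_simplex R n)) (rV_uncons z).2.
Proof.
move=> uB B0; have [zR|zR] := pselect (reference_simplex (rV_uncons z).2); last first.
  by rewrite reference_layer// patchE memNset// mulr0 normr0.
rewrite patchE mem_set//.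
have [zT|zT] := pselect (osimplex T (layer_map w (thickness k) z)); last first.
  by rewrite layer_integrand0// normr0 mulr_ge0// dcutoff_ge0.
rewrite layer_integrandE// normrM ger0_norm ?dcutoff_ge0//.
rewrite ler_wpM2l ?dcutoff_ge0// normrM -[leRHS]mul1r ler_pM//.
  rewrite ger0_norm; last first.
    by apply: prodr_ge0 => v _;
      case/andP: (cutoff_ge0_le1 (bary lam v (layer_map w (thickness k) z) / thickness k)).
  by apply: prodr_ile1 => v _; exact: cutoff_ge0_le1.
exact/uB/osimplex_csimplex.
Qed.

Lemma measurable_cell_fun : measurable_fun (osimplex T) u.
Proof.
apply: within_continuous_measurable_rV; first exact: (measurable_osimplex Tlam).
by apply: continuous_subspaceW cu => x; exact: osimplex_csimplex.
Qed.

Lemma cell_fun_bounded : exists2 B, 0 <= B & forall x, csimplex T x -> `|u x| <= B.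
Proof. exact: within_continuous_bounded (compact_csimplex Tlam) cu. Qed.

Lemma integrable_layer dl w' :
  mu.-integrable (osimplex T) (EFin \o (fun x => layer w' dl x * u x)).
Proof.
have [B B0 uB] := cell_fun_bounded.
have [C C0 lC] := within_continuous_bounded (compact_csimplex Tlam)
  (continuous_subspaceT (@continuous_layer w' dl)).
apply: (@bounded_integrable _ _ _ _ _ _ (C * B)).
- exact: (measurable_osimplex Tlam).
- exact: (osimplex_lty Tlam).
- apply: measurable_funM; last exact: measurable_cell_fun.
  apply: measurable_funTS; apply: continuous_measurable_rV; exact: continuous_layer.
- move=> x /osimplex_csimplex xT; rewrite normrM ler_pM//; [exact: lC|exact: uB].
Qed.

Lemma continuous_face_map : continuous (fun s : 'rV[R]_n => face_map s).
Proof.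
move=> s; apply: (@cvg_rV_coord _ _ _ (nbhs s)) => i.
rewrite mxE [X in _ + X]mxE; under eq_fun do rewrite mxE [X in _ + X]mxE.
apply: (@cvgD _ _ _ (nbhs s)); first exact: cvg_cst.
apply: (@cvg_sumr _ _ (nbhs s)) => j _.
by apply: (@cvgM _ _ (nbhs s)); [exact: coord_continuous|exact: cvg_cst].
Qed.

Lemma integrable_face : (lebesgue_rV n).-integrable (@reference_simplex R n)
  (EFin \o (fun s => u (face_map s))).
Proof.
have [B B0 uB] := cell_fun_bounded.
apply: (@bounded_integrable _ _ _ _ _ _ B).
- exact: measurable_reference_simplex.
- exact: reference_simplex_lty.
- apply: within_continuous_measurable_rV; first exact: measurable_reference_simplex.
  apply: (within_continuous_comp cu continuous_face_map); exact: face_map_closed.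
- by move=> s /face_map_closed; exact: uB.
Qed.

(** Change of variables, then dominated convergence: the integrand is at most a
    bound of |u| times the derivative of the cut-off times the indicator of the
    reference simplex, which is integrable. *)
Lemma layer_limit :
  \int[mu]_(x in osimplex T) (layer w (thickness k) x * u x) @[k --> \oo] -->
  `|\det (frame T w)| * \int[lebesgue_rV n]_(s in @reference_simplex R n) u (face_map s).
Proof.
have mT := measurable_osimplex Tlam.
have mR := @measurable_reference_simplex R n.
have d0 : `|\det (frame T w)| != 0.
  by rewrite normr_eq0 -unitfE -unitmxE (frame_unit Tlam cardT wT).
pose H k := (fun x => layer w (thickness k) x * u x) \_ (osimplex T).
have iH k : mu.-integrable setT (EFin \o H k).
  have := (integrable_mkcond _ mT).1 (integrable_layer (thickness k) w).
  by rewrite /H restrict_EFin.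
have Hk k : \int[mu]_(x in osimplex T) (layer w (thickness k) x * u x) =
    `|\det (frame T w)| * \int[mu]_z layer_integrand k z.
  rewrite Rintegral_mkcond -/(H k) /layer_integrand -/(H k).
  have sc := scales_layer_map wT (thickness_gt0 k).
  rewrite RintegralZl//; last exact: (scales_integrable sc (iH k)).
  rewrite (scales_Rintegral sc (iH k)).
  have : thickness k != 0 by rewrite gt_eqF// thickness_gt0.
  move: (thickness k) (Rintegral _ _ _) => dl I dl0; by field; rewrite dl0.
under eq_fun do rewrite Hk.
apply: cvgM; first exact: cvg_cst.
have [B B0 uB] := cell_fun_bounded.
have lim_int (h : 'rV[R]_n -> R) := @Rintegral_rV_cons R n dcutoff h
  (continuous_measurable_fun (@continuous_dcutoff R)) (@dcutoff_ge0 R) integral_dcutoff.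
have iface : (lebesgue_rV n).-integrable setT
    (EFin \o ((fun s => u (face_map s)) \_ (@reference_simplex R n))).
  by rewrite -restrict_EFin; apply/(integrable_mkcond _ mR).1; exact: integrable_face.
have iB : (lebesgue_rV n).-integrable setT
    (EFin \o ((fun=> B) \_ (@reference_simplex R n))).
  rewrite -restrict_EFin; apply/(integrable_mkcond _ mR).1.
  apply: (@bounded_integrable _ _ _ _ _ _ B) => //; first exact: reference_simplex_lty.
  by move=> x _; rewrite ger0_norm.
have [_ limE] := lim_int _ iface.
rewrite [X in _ --> X]Rintegral_mkcond -limE.
apply: (dominated_Rintegral_cvg (g := fun z => dcutoff (rV_uncons z).1 *
   ((fun=> B) \_ (@reference_simplex R n)) (rV_uncons z).2)) => //.
- move=> k; apply: measurable_funM => //.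
  have /measurable_EFinP mH := measurable_int _ (iH k).
  apply: (measurableT_comp mH).
  by have [_ ] := scales_layer_map wT (thickness_gt0 k).
- by have [] := lim_int _ iB.
- by move=> k z _; exact: layer_integrand_bound.
Qed.

End layer_limit.

End cell_cutoff.

(** * The divergence theorem on a cell *)

Section divergence.
Context {R : realType} {n : nat}.
Variable m : mesh R n.+1.
Variables (Om : set 'rV[R]_n.+1) (U : 'rV[R]_n.+1 -> 'rV[R]_n.+1)
  (DU : 'rV[R]_n.+1 -> 'M[R]_n.+1).
Hypothesis oOm : open Om.
Hypothesis hU : W1oo Om U DU.
Hypothesis hUc : {within closure Om, continuous U}.
Variables (T : {set node m}) (lam : (node m -> 'rV[R]_n.+1) * (node m -> R)).
Hypothesis Tlam : is_bary T lam.
Hypothesis cardT : #|T| = n.+2.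
Hypothesis TOm : osimplex T `<=` Om.
Hypothesis TcOm : csimplex T `<=` closure Om.
Local Notation mu := (lebesgue_rV n.+1).

Let mT := measurable_osimplex Tlam.

Lemma flux_continuous g : {within csimplex T, continuous (fun x => dotp (U x) g)}.
Proof.
apply/subspace_continuousP => x Tx.
have cU := (subspace_continuousP _ _).1 (continuous_subspaceW TcOm hUc) x Tx.
apply: (@continuous_cvg _ _ _ (within (csimplex T) (nbhs x)) _ U (fun y => dotp y g) _ _ cU).
rewrite (_ : (fun y => dotp y g) = dotp g); first exact: continuous_dotp.
by apply/funext => y; exact: dotpC.
Qed.

Lemma ess_bounded_integrable u : ess_bounded Om u -> mu.-integrable (osimplex T) (EFin \o u).
Proof.
move=> [mu_u [B uB]].
have mu' : measurable_fun (osimplex T) u 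
    by apply: measurable_funS mu_u => //; exact: open_measurable_rV.
apply/integrableP; split; first exact/measurable_EFinP.
apply: (@le_lt_trans _ _ (\int[mu]_(x in osimplex T) `|B|%:E)%E).
  apply: ae_ge0_le_integral => //.
  - by apply: measurableT_comp => //; exact/measurable_EFinP.
  - apply: filterS uB => x uxB Tx; rewrite /= lee_fin.
    exact: le_trans (uxB (TOm Tx)) (ler_norm B).
by rewrite integral_cst// lte_mul_pinfty// (osimplex_lty Tlam).
Qed.

Lemma integrable_div : mu.-integrable (osimplex T) (EFin \o (fun x => \tr (DU x))).
Proof.
have [_ DUb _] := hU.
have := @integrable_sum _ _ _ mu _ mT _ (index_enum _) xpredT (fun i x => (DU x i i)%:E)
  (fun i _ => ess_bounded_integrable (DUb i i)).
by apply: eq_integrable => // x _ /=; rewrite sumEFin.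
Qed.

Lemma integrable_mul_cutoff u dl : mu.-integrable (osimplex T) (EFin \o u) ->
  mu.-integrable (osimplex T) (EFin \o (fun x => u x * cell_cutoff T lam dl x)).
Proof.
move=> iu; have /measurable_EFinP mu_u := measurable_int _ iu.
apply: (@dominated_Rintegrable _ _ _ _ _ _ (fun x => `|u x|)) => //.
- apply: measurable_funM => //; apply: measurable_funTS.
  by apply: continuous_measurable_rV; exact: continuous_cell_cutoff.
- move=> x _; rewrite normrM ler_piMr//.
  by have /andP[c0 c1] := cell_cutoff_ge0_le1 T lam dl x; rewrite ger0_norm.
- exact: integrable_norm.
Qed.

(** The weak derivative of U, component by component, is tested with the
    cut-off of the cell; summation over the axes collects the divergence on one
    side and the gradients of the barycentric coordinates on the other. *)
Lemma weak_divergence_cutoff dl : 0 < dl ->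
  \sum_(w in T) \int[mu]_(x in osimplex T) (layer T lam w dl x * dotp (U x) (lam.1 w)) =
  - \int[mu]_(x in osimplex T) (\tr (DU x) * cell_cutoff T lam dl x).
Proof.
move=> dl0; have [_ DUb Uw] := hU.
have il w g : mu.-integrable (osimplex T)
    (EFin \o (fun x => layer T lam w dl x * dotp (U x) g)).
  by apply: integrable_layer => //; exact: flux_continuous.
have test i : \int[mu]_(x in osimplex T) (U x ord0 i * partial i (cell_cutoff T lam dl) x) =
   - \int[mu]_(x in osimplex T) (DU x i i * cell_cutoff T lam dl x).
  have := Uw i i _ (cell_cutoff_C1_c Tlam dl0 TOm).
  rewrite (Rintegral_support _ TOm) => [|x _ /(notin_osimplex Tlam)[v vT v0]]; last first.
    rewrite partial_cell_cutoff big1 ?mulr0// => w wT.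
    by rewrite (layer_outside dl0 wT vT) ?mul0r// (le_trans v0)// ltW.
  rewrite (Rintegral_support _ TOm) => [//|x _ /(notin_osimplex Tlam)[v vT v0]].
  by rewrite (cell_cutoff_outside dl0 vT) ?mulr0// (le_trans v0)// ltW.
rewrite -Rintegral_sum//.
transitivity (\int[mu]_(x in osimplex T)
    \sum_i (U x ord0 i * partial i (cell_cutoff T lam dl) x)).
  apply: eq_Rintegral => x _; under [RHS]eq_bigr do rewrite partial_cell_cutoff mulr_sumr.
  rewrite exchange_big; apply: eq_bigr => w _; rewrite mulr_sumr.
  by apply: eq_bigr => i _; rewrite mulrCA.
rewrite Rintegral_sum//; last first.
  move=> i _.
  have := @integrable_sum _ _ _ mu _ mT _ (index_enum _) (mem T)
    (fun w x => (layer T lam w dl x * dotp (U x) (lam.1 w ord0 i *: delta_mx ord0 i))%:E)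
    (fun w _ => il w _).
  apply: eq_integrable => // x _ /=; rewrite sumEFin partial_cell_cutoff mulr_sumr; congr EFin.
  by apply: eq_bigr => w _; rewrite dotpZr dotp_delta; ring.
under eq_bigr do rewrite test.
rewrite sumrN; congr (- _).
rewrite -Rintegral_sum//.
  by apply: eq_Rintegral => x _; rewrite /mxtrace mulr_suml.
by move=> i _; apply: integrable_mul_cutoff; exact: ess_bounded_integrable.
Qed.

Lemma div_cutoff_limit :
  \int[mu]_(x in osimplex T) (\tr (DU x) * cell_cutoff T lam (thickness k) x) @[k --> \oo] -->
  \int[mu]_(x in osimplex T) \tr (DU x).
Proof.
have idiv := integrable_div.
apply: (dominated_Rintegral_cvg (g := fun x => `|\tr (DU x)|)) => //.
- by move=> k; apply/measurable_EFinP; exact: measurable_int (integrable_mul_cutoff _ idiv).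
- move=> x Tx; rewrite -[X in _ --> X]mulr1; apply: cvgM; first exact: cvg_cst.
  exact: (cell_cutoff_cvg1 Tlam Tx).
- exact: integrable_norm.
- move=> k x _; rewrite normrM ler_piMr//.
  by have /andP[c0 c1] := cell_cutoff_ge0_le1 T lam (thickness k) x; rewrite ger0_norm.
Qed.

(** Both sides of the formula for the cut-off converge as the thickness tends
    to 0. On each face the limit is |det A| times the integral of U . grad
    lambda_w, and |det A| |grad lambda_w| is the area factor. *)
Lemma divergence_cell :
  \int[mu]_(x in osimplex T) \tr (DU x) =
  \sum_(w in T) face_integral (T :\ w) (fun x => dotp (U x) (outward_normal T (T :\ w))).
Proof.
have lim1 := div_cutoff_limit.
have lim2 : (- \sum_(w in T) \int[mu]_(x in osimplex T)
    (layer T lam w (thickness k) x * dotp (U x) (lam.1 w))) @[k --> \oo] -->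
  - \sum_(w in T) (`|\det (frame T w)| * \int[lebesgue_rV n]_(s in @reference_simplex R n)
     dotp (U (face_vertex (T :\ w) 0 + s *m face_jacobian (T :\ w))) (lam.1 w)).
  apply: cvgN; apply: (@cvg_sumr _ _ \oo) => w wT.
  by apply: (layer_limit Tlam cardT wT); exact: flux_continuous.
have lim12 : (- \sum_(w in T) \int[mu]_(x in osimplex T)
    (layer T lam w (thickness k) x * dotp (U x) (lam.1 w))) @[k --> \oo] -->
  \int[mu]_(x in osimplex T) \tr (DU x).
  by under eq_fun do rewrite weak_divergence_cutoff ?thickness_gt0// opprK.
have -> := cvg_unique (@Rhausdorff R) lim12 lim2.
rewrite -sumrN; apply: eq_bigr => w wT; rewrite /face_integral (area_factor Tlam cardT wT).
rewrite (outward_normalE Tlam cardT wT) -mulrN -mulrA; congr (_ * _).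
have g0 := enorm_grad_gt0 Tlam cardT wT.
have iF := integrable_face Tlam cardT wT (@flux_continuous (lam.1 w)).
rewrite (_ : Rintegral _ _ (fun s => dotp _ (face_outward _ _)) =
    - (enorm (lam.1 w))^-1 * \int[lebesgue_rV n]_(s in @reference_simplex R n)
     dotp (U (face_vertex (T :\ w) 0 + s *m face_jacobian (T :\ w))) (lam.1 w)).
  by rewrite mulrA mulrN mulfV ?gt_eqF// mulN1r.
rewrite -RintegralZl//; last exact: measurable_reference_simplex.
by apply: eq_Rintegral => s _; rewrite dotpNr dotpZr mulNr.
Qed.

End divergence.

(** * One step of the scheme *)

(** The inflow and source data enter only through bounds on the sets where they
    are prescribed. The integral of a real function is the difference of the
    integrals of its positive and negative parts, and each of these, as a
    supremum over simple functions, is monotone for all nonnegative functions;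
    domination by an integrable function keeps both finite. *)
Section nonmeasurable_integral.
Context {d : measure_display} {T : measurableType d} {R : realType}.
Variable mu : {measure set T -> \bar R}.
Implicit Types (D : set T) (f g h : T -> R).

Lemma ge0_integral_mono D (f g : T -> \bar R) : (forall x, D x -> (0 <= f x)%E) ->
  (forall x, D x -> (f x <= g x)%E) ->
  (\int[mu]_(x in D) f x <= \int[mu]_(x in D) g x)%E.
Proof.
move=> f0 fg; rewrite !ge0_integralE//; last first.
  by move=> x Dx; apply: le_trans (f0 x Dx) (fg x Dx).
apply: ereal_sup_le => _ [h hf <-]; exists h => // x.
apply: le_trans (hf x) _; rewrite !patchE; case: ifPn => // xD.
exact/fg/set_mem.
Qed.

Lemma Rintegral_mono D h1 h2 g : measurable D -> mu.-integrable D (EFin \o g) ->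
  (forall x, D x -> `|h1 x| <= g x) -> (forall x, D x -> `|h2 x| <= g x) ->
  (forall x, D x -> h1 x <= h2 x) ->
  \int[mu]_(x in D) h1 x <= \int[mu]_(x in D) h2 x.
Proof.
move=> mD ig h1g h2g h12.
have goo : (\int[mu]_(x in D) (g x)%:E < +oo)%E.
  have /integrableP[_] := ig; apply: le_lt_trans; apply: ge0_integral_mono => x Dx.
    by rewrite lee_fin; apply: le_trans (h1g x Dx).
  by rewrite lee_fin ler_norm.
have fin h : (forall x, D x -> `|h x| <= g x) ->
    (\int[mu]_(x in D) (EFin \o h)^\+ x)%E \is a fin_num /\
    (\int[mu]_(x in D) (EFin \o h)^\- x)%E \is a fin_num.
  move=> hg; split; (rewrite ge0_fin_numE ?integral_ge0//; apply: le_lt_trans goo;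
    apply: ge0_integral_mono => // x Dx).
    rewrite funeposE /= -EFin_max lee_fin ge_max (le_trans (ler_norm _) (hg x Dx)).
    exact: le_trans (hg x Dx).
  rewrite funenegE -[(- _)%E]/((- h x)%:E) -EFin_max lee_fin ge_max.
  rewrite (le_trans _ (hg x Dx)) ?(le_trans _ (hg x Dx))// -normrN; exact: ler_norm.
have [[p1 n1] [p2 n2]] := (fin _ h1g, fin _ h2g).
rewrite /Rintegral fine_le//.
- by rewrite integralE fin_numB p1 n1.
- by rewrite integralE fin_numB p2 n2.
rewrite integralE [leRHS]integralE; apply: leeB.
  apply: ge0_integral_mono => // x Dx; rewrite !funeposE -!EFin_max lee_fin.
  by rewrite ge_max !le_max lexx orbT h12.
apply: ge0_integral_mono => // x Dx; rewrite !funenegE -!EFinN -!EFin_max lee_fin.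
by rewrite ge_max !le_max lexx orbT lerN2 h12.
Qed.

(** The positive and negative parts are exchanged; the case of an infinite part
    is harmless because fine sends both infinities to 0. *)
Lemma Rintegral_oppr D h : \int[mu]_(x in D) (- h x) = - \int[mu]_(x in D) h x.
Proof.
rewrite /Rintegral integralE [in RHS]integralE.
have -> : (fun x => (- h x)%:E) = (\- (fun x => (h x)%:E))%E by apply/funext.
rewrite funeposN funenegN.
have := integral_ge0 mu (D := D) (fun x _ => funepos_ge0 (fun x => (h x)%:E) x).
have := integral_ge0 mu (D := D) (fun x _ => funeneg_ge0 (fun x => (h x)%:E) x).
case: (integral mu D _^\+%E) => [a| |//]; case: (integral mu D _^\-%E) => [b| |//] //= _ _;
  by rewrite ?oppr0// opprB.
Qed.

End nonmeasurable_integral.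

(** An open cell is an open subset of the closure of Om, and Om is the interior
    of its closure. *)
Lemma osimplex_domain {R : realType} {d : nat} (m : mesh R d) (Om : set 'rV[R]_d)
    (T : {set node m}) :
  (0 < d)%N -> triangulation m Om -> T \in cells m -> osimplex T `<=` Om.
Proof.
case: d => [//|n] in m Om T * => _ [_ OmE clE free _] TC.
have [cT fT] := free T TC; have [lam Tlam] := is_bary_exists cT fT.
rewrite OmE -open_subsetE; last exact: open_osimplex Tlam.
by move=> x /osimplex_csimplex Tx; rewrite clE; exists T.
Qed.

Section one_step.
Context {R : realType} {n : nat}.
Variable m : mesh R n.+1.
Variables (Om : set 'rV[R]_n.+1) (U : 'rV[R]_n.+1 -> 'rV[R]_n.+1)
  (DU : 'rV[R]_n.+1 -> 'M[R]_n.+1) (f : 'rV[R]_n.+1 -> R) (k : nat).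
Hypothesis hm : triangulation m Om.
Hypothesis hU : W1oo Om U DU.
Hypothesis hUc : {within closure Om, continuous U}.
Hypothesis hf : (lebesgue_rV n.+1).-integrable Om (EFin \o f).
Hypothesis hcons : locally_conservative m k DU f.
Local Notation mu := (lebesgue_rV n.+1).
Implicit Types (T S F : {set node m}) (w : node m).

Lemma open_domain : open Om.
Proof. by have [_ -> _ _ _] := hm; exact: open_interior. Qed.

Lemma cell_is_cell T : T \in cells m -> is_cell T.
Proof. by have [_ _ _ + _] := hm; exact. Qed.

Lemma cell_bary T : T \in cells m -> exists lam, is_bary T lam.
Proof. by move=> /cell_is_cell[cT fT]; exact: is_bary_exists. Qed.

Lemma csimplex_closure T : T \in cells m -> csimplex T `<=` closure Om.
Proof. by have [_ _ -> _ _] := hm => TC x Tx; exists T. Qed.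

Lemma cell_conforming T S : T \in cells m -> S \in cells m ->
  csimplex T `&` csimplex S = csimplex (T :&: S).
Proof. by have [_ _ _ _ +] := hm; exact. Qed.

Local Notation un T w := (fun x => dotp (U x) (outward_normal T (T :\ w))).

Lemma poly_fun1 : @poly_fun R n.+1 k (fun=> 1).
Proof.
pose z : {ffun 'I_n.+1 -> 'I_k.+1} := [ffun=> ord0].
exists (fun a => (a == z)%:R) => x.
rewrite (bigD1 z)/=; last by rewrite big1// => i _; rewrite ffunE.
rewrite eqxx mul1r big1 => [|i _]; last by rewrite ffunE.
by rewrite big1 ?addr0// => a /andP[_ /negbTE ->]; rewrite mul0r.
Qed.

(** Local conservation, tested with the constant 1, and the divergence theorem. *)
Lemma flux_balance T : T \in cells m ->
  \sum_(w in T) face_integral (T :\ w) (un T w) = \int[mu]_(x in osimplex T) f x.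
Proof.
move=> TC; have [lam Tlam] := cell_bary TC; have [cT _] := cell_is_cell TC.
rewrite -(divergence_cell open_domain hU hUc Tlam cT
  (osimplex_domain (ltn0Sn n) hm TC) (csimplex_closure TC)).
have := hcons TC poly_fun1.
by under eq_Rintegral do rewrite mulr1; under [RHS]eq_Rintegral do rewrite mulr1.
Qed.

Lemma is_face_cell T w : T \in cells m -> w \in T -> is_face (T :\ w).
Proof.
move=> TC wT; have [cT _] := cell_is_cell TC.
rewrite /is_face (card_face cT wT) eqxx /=; apply/existsP; exists T.
by rewrite TC subD1set.
Qed.

(** The summand vanishes off the faces of T, which are the sets obtained by
    deleting one vertex. *)
Lemma sum_faces (P : pred {set node m}) (G : {set node m} -> R) T : T \in cells m ->
  (forall F, ~~ (F \subset T) -> G F = 0) ->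
  \sum_(F | is_face F && P F) G F = \sum_(w in T | P (T :\ w)) G (T :\ w).
Proof.
move=> TC G0; have [cT _] := cell_is_cell TC.
pose H F := if P F then G F else 0.
transitivity (\sum_(F in [set T :\ w | w in T]%SET) H F).
  rewrite big_mkcond [RHS]big_mkcond; apply: eq_bigr => F _; rewrite /H.
  have [/imsetP[w wT ->]|nF] := boolP (F \in _); first by rewrite is_face_cell.
  case: ifPn => // /andP[/andP[/eqP cF _] PF]; apply: G0; apply: contra nF => FT.
  by have [w wT ->] := sub_faceP cT cF FT; exact: imset_f.
rewrite big_imset; first by rewrite [RHS]big_mkcondr.
move=> v w vT wT /setP/(_ v); rewrite !inE eqxx vT andbT /=.
by rewrite andbT; case: eqVneq.
Qed.

(** Three distinct cells cannot share a face: their outward normals would be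
    pairwise opposite, so that one of them would be its own opposite. *)
Lemma face_neighbors T w : T \in cells m -> w \in T ->
  boundary_face (T :\ w) \/ interior_face (T :\ w).
Proof.
move=> TC wT; have fF := is_face_cell TC wT.
rewrite /boundary_face /interior_face fF /=.
have : (0 < nb_cells (T :\ w))%N.
  by apply/card_gt0P; exists T; rewrite inE TC subD1set.
have [|/card_gt2P[T1 [T2 [T3]]]] := leqP (nb_cells (T :\ w)) 2.
  by case: nb_cells => [|[|[|?]]]//; [left|right].
rewrite !inE => -[[/andP[C1 F1] /andP[C2 F2] /andP[C3 F3]] [T12 T23 T31]] _; exfalso.
have [cT _] := cell_is_cell TC.
have cF := card_face cT wT.
have opp S S' : S \in cells m -> S' \in cells m -> S != S' -> T :\ w \subset S ->
    T :\ w \subset S' -> outward_normal S' (T :\ w) = - outward_normal S (T :\ w).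
  move=> CS CS' SS' FS FS'.
  by apply: outward_normal_opposite => //; [exact: cell_is_cell|exact: cell_is_cell|exact: cell_conforming].
have n12 := opp _ _ C1 C2 T12 F1 F2; have n23 := opp _ _ C2 C3 T23 F2 F3.
have n31 := opp _ _ C3 C1 T31 F3 F1.
have [c1 _] := cell_is_cell C1; have [lam1 T1l] := cell_bary C1.
have [w1 w1T FE] := sub_faceP c1 cF F1.
have := unit_normal_outward T1l c1 w1T; rewrite -FE => -[n1 _].
have : outward_normal T1 (T :\ w) = - outward_normal T1 (T :\ w).
  by rewrite {1}n31 n23 n12 !opprK.
move/(congr1 (dotp (outward_normal T1 (T :\ w)))); rewrite dotpNr n1 => /eqP.
by rewrite -subr_eq0 opprK -mulr2n pnatr_eq0.
Qed.

Section test_cell.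
Variable T : {set node m}.
Hypothesis TC : T \in cells m.

Definition cell_indicator : broken m := fun S _ => (S == T)%:R.

Lemma V_h0_cell_indicator : V_h0 cell_indicator.
Proof. by move=> S _; exists (S == T)%:R. Qed.

Lemma grad_cell_indicator S x : grad (cell_indicator S) x = 0.
Proof.
apply/rowP => i; rewrite !mxE /partial.
by have [_ ->] := is_derive_cst ((S == T)%:R : R) x (delta_mx ord0 i).
Qed.

Lemma sum_cell_indicator (F : {set node m}) (V : lmodType R) (h : {set node m} -> V) x :
  \sum_(S in cells m | F \subset S) cell_indicator S x *: h S =
  if F \subset T then h T else 0.
Proof.
case: ifPn => FT.
  rewrite (bigD1 T) ?TC//= /cell_indicator eqxx scale1r big1 ?addr0// => S /andP[_ /negbTE ->].
  by rewrite scale0r.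
rewrite big1// => S /andP[_ FS]; rewrite /cell_indicator.
by case: eqVneq => [ST|_]; [rewrite -ST FS in FT|rewrite scale0r].
Qed.

Lemma jump_cell_indicator F x :
  jump F cell_indicator x = if F \subset T then outward_normal T F else 0.
Proof. exact: sum_cell_indicator. Qed.

Lemma sum_cells_indicator (g : {set node m} -> R) :
  \sum_(S in cells m) (S == T)%:R * g S = g T.
Proof.
rewrite (bigD1 T)//= eqxx mul1r big1 ?addr0// => S /andP[_ /negbTE ->].
by rewrite mul0r.
Qed.

End test_cell.

Lemma face_integral0 F : @face_integral R n.+1 m F (fun=> 0) = 0.
Proof. by rewrite /face_integral Rintegral_cst ?mul0r ?mulr0//; exact: measurable_reference_simplex. Qed.

Lemma face_integral_mono T w (h1 h2 : 'rV[R]_n.+1 -> R) B : T \in cells m -> w \in T ->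
  (forall x, osimplex (T :\ w) x -> `|h1 x| <= B * `|un T w x|) ->
  (forall x, osimplex (T :\ w) x -> `|h2 x| <= B * `|un T w x|) ->
  (forall x, osimplex (T :\ w) x -> h1 x <= h2 x) ->
  face_integral (T :\ w) h1 <= face_integral (T :\ w) h2.
Proof.
move=> TC wT h1B h2B h12; have [lam Tlam] := cell_bary TC; have [cT _] := cell_is_cell TC.
apply: ler_wpM2l; first exact: sqrtr_ge0.
have iun := integrable_face Tlam cT wT
  (@flux_continuous _ _ _ _ _ hUc T (csimplex_closure TC) (outward_normal T (T :\ w))).
have mR := @measurable_reference_simplex R n.
have inF s : reference_simplex s -> osimplex (T :\ w)
    (face_vertex (T :\ w) 0 + s *m face_jacobian (T :\ w)).
  exact: (frame_map_osimplex_face Tlam cT wT).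
apply: (@Rintegral_mono _ _ _ (lebesgue_rV n) (@reference_simplex R n) _ _
  (fun s => B * `|un T w (face_vertex (T :\ w) 0 + s *m face_jacobian (T :\ w))|)) => //.
- by have := @integrableZl _ _ _ _ _ mR B _ (integrable_norm iun).
- by move=> s /inF; exact: h1B.
- by move=> s /inF; exact: h2B.
- by move=> s /inF; exact: h12.
Qed.

Lemma face_integralZ T w c : T \in cells m -> w \in T ->
  face_integral (T :\ w) (fun x => c * un T w x) = c * face_integral (T :\ w) (un T w).
Proof.
move=> TC wT; have [lam Tlam] := cell_bary TC; have [cT _] := cell_is_cell TC.
have iun := integrable_face Tlam cT wT
  (@flux_continuous _ _ _ _ _ hUc T (csimplex_closure TC) (outward_normal T (T :\ w))).
rewrite /face_integral RintegralZl//; first by rewrite mulrCA.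
exact: measurable_reference_simplex.
Qed.

Section step.
Variables (dt : R) (ct cI : 'rV[R]_n.+1 -> R) (Cold C : broken m).
Hypothesis dt0 : 0 < dt.
Hypothesis hC : BMS_step Om U f ct cI dt Cold C.
Local Notation inflow := (inflow_face Om U).

(** The jump of the indicator of T across a face is the outward normal of T if
    the face belongs to T, and 0 otherwise. *)
Lemma cell_equation T : T \in cells m ->
  \int[mu]_(x in osimplex T) (dt^-1 * C T x) +
  \sum_(w in T | ~~ inflow (T :\ w)) face_integral (T :\ w)
    (fun x => dotp (upwind U (T :\ w) C x) (outward_normal T (T :\ w))) =
  \int[mu]_(x in osimplex T) (f x * C_star f ct C T x) +
  \int[mu]_(x in osimplex T) (dt^-1 * Cold T x) -
  \sum_(w in T | inflow (T :\ w)) face_integral (T :\ w) (fun x => un T w x * cI x).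
Proof.
move=> TC; have [_ /(_ _ (V_h0_cell_indicator T))] := hC.
have volE (g : broken m) (h : broken m) :
    (forall S x, h S x = g S x * cell_indicator T S x) ->
    \sum_(S in cells m) \int[mu]_(x in osimplex S) h S x = \int[mu]_(x in osimplex T) g T x.
  move=> hE; rewrite -[RHS](sum_cells_indicator TC (fun S => \int[mu]_(x in osimplex S) g S x)).
  apply: eq_bigr => S SC; under eq_Rintegral do rewrite hE /cell_indicator.
  case: eqVneq => _; first by rewrite mul1r; apply: eq_Rintegral => x _; rewrite mulr1.
  have [lam Slam] := cell_bary SC.
  under eq_Rintegral do rewrite mulr0.
  by rewrite Rintegral_cst ?mul0r//; exact: (measurable_osimplex Slam).
rewrite (volE (fun S x => dt^-1 * C S x)); last first.
  by move=> S x; rewrite grad_cell_indicator dotp0r mulr0 subr0.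
rewrite (volE (fun S x => f x * C_star f ct C S x))//.
rewrite (volE (fun S x => dt^-1 * Cold S x))//.
rewrite (@sum_faces (fun F => ~~ inflow F) _ T TC); last first.
  move=> F FT; rewrite -[RHS](face_integral0 F); congr face_integral; apply/funext => x.
  by rewrite (jump_cell_indicator TC) (negbTE FT) dotp0r.
rewrite (eq_bigl (fun F => is_face F && inflow F)); last first.
  by move=> F; rewrite /inflow_face /boundary_face; case: is_face.
have inE' F x : \sum_(S in cells m | F \subset S)
    dotp (U x) (outward_normal S F) * cI x * cell_indicator T S x =
    if F \subset T then dotp (U x) (outward_normal T F) * cI x else 0.
  rewrite -(@sum_cell_indicator T TC F R^o (fun S => dotp (U x) (outward_normal S F) * cI x) x).
  by apply: eq_bigr => S _; rewrite mulrC.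
rewrite (@sum_faces (fun F => inflow F) _ T TC); last first.
  move=> F FT; rewrite -[RHS](face_integral0 F); congr face_integral; apply/funext => x.
  by rewrite inE' (negbTE FT).
move=> E.
transitivity (\int[mu]_(x in osimplex T) (dt^-1 * C T x) +
  \sum_(w in T | ~~ inflow (T :\ w)) face_integral (T :\ w)
    (fun x => dotp (upwind U (T :\ w) C x) (jump (T :\ w) (cell_indicator T) x))).
  congr (_ + _); apply: eq_bigr => w _; congr face_integral; apply/funext => x.
  by rewrite (jump_cell_indicator TC) subD1set.
rewrite E; congr (_ - _); apply: eq_bigr => w _; congr face_integral; apply/funext => x.
by rewrite inE' subD1set.
Qed.

Variable c : {set node m} -> R.
Hypothesis Cc : forall T x, T \in cells m -> C T x = c T.

Lemma boundary_cell T S F : T \in cells m -> S \in cells m -> boundary_face F ->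
  F \subset T -> F \subset S -> S = T.
Proof.
move=> TC SC /andP[_ /eqP]; rewrite /nb_cells => /mem_card1[S' S'E] FT FS.
by have := S'E T; have := S'E S; rewrite !inE TC SC FT FS /= => /esym/eqP -> /esym/eqP.
Qed.

Lemma upwind_boundary T w x : T \in cells m -> w \in T -> boundary_face (T :\ w) ->
  dotp (upwind U (T :\ w) C x) (outward_normal T (T :\ w)) = c T * un T w x.
Proof.
move=> TC wT bF; have /andP[_ /eqP nb1] := bF.
rewrite /upwind /interior_face nb1 andbF addr0 /average nb1 invr1 scale1r.
rewrite (bigD1 T) ?TC ?subD1set//= big1 ?addr0 => [|S /andP[/andP[SC FS] /eqP ST]].
  by rewrite dotpZl Cc.
by case: ST; apply: (boundary_cell TC SC bF); rewrite ?subD1set.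
Qed.

(** Averaging with the jump term selects the value on the side from which U
    comes; the two outward normals of the face being opposite, the jump is c T
    - c S times that of T. *)
Lemma upwind_interior T w x : T \in cells m -> w \in T -> interior_face (T :\ w) ->
  exists2 S, S \in cells m &
    dotp (upwind U (T :\ w) C x) (outward_normal T (T :\ w)) =
    (if 0 <= un T w x then c T else c S) * un T w x.
Proof.
move=> TC wT iF; have /andP[_ /eqP nb2] := iF.
set F := T :\ w in iF nb2 *.
have FT : F \subset T by exact: subD1set.
have /mem_card1[S SE] : #|[predD1 [pred S in cells m | F \subset S] & T]| = 1%N.
  by move: nb2; rewrite /nb_cells (cardD1 T) inE TC FT add1n => -[].
have := SE S; rewrite !inE eqxx => /and3P[ST SC FS].
exists S => //.
have sumE (V : nmodType) (h : {set node m} -> V) :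
    \sum_(S' in cells m | F \subset S') h S' = h T + h S.
  rewrite (bigD1 T) ?TC//=; congr (_ + _); apply: big_pred1 => S'.
  by have := SE S'; rewrite !inE andbC.
have [cT _] := cell_is_cell TC; have [lam Tlam] := cell_bary TC.
have nST : outward_normal S F = - outward_normal T F.
  apply: outward_normal_opposite => //; [exact: cell_is_cell|exact: cell_is_cell| |
    exact: cell_conforming|exact: (card_face cT wT)].
  by rewrite eq_sym.
have [nn _] := unit_normal_outward Tlam cT wT.
have absE : `|dotp (U x) (face_normal F)| = `|un T w x|.
  by have [->|->] := face_normal_pm Tlam cT wT; rewrite ?dotpNr ?normrN.
rewrite /upwind iF absE /average /jump !sumE nb2 nST !(Cc _ TC) !(Cc _ SC).
rewrite dotpDl !dotpZl !dotpDl !dotpZl dotpNl -/F nn.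
by case: (ger0P (dotp (U x) (outward_normal T F))) => _; field.
Qed.

(** A face contained in Gamma_minus is there a face F' of some cell T'. An
    interior point of the face lies in T and T', so by conformity all the
    vertices of the face belong to T', which is T because a boundary face has
    only one cell; and F' is the face because they share a relative interior
    point. *)
Lemma inflow_faceP T w x : T \in cells m -> w \in T -> inflow (T :\ w) ->
  osimplex (T :\ w) x -> un T w x < 0 /\ Gamma_minus m Om U x.
Proof.
move=> TC wT /andP[bF /asboolP FG] xF; split; last exact: FG.
have [_ [T' [F' [T'C F'T' bF' xF']]]] := FG _ xF.
have [lam Tlam] := cell_bary TC.
have xT : csimplex T x.
  apply/(csimplex_cellP Tlam).
  by have /osimplex_csimplex/(csimplexP Tlam _ (subD1set T w))[] := xF.
have [lam' T'lam] := cell_bary T'C.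
have xT' : csimplex T' x.
  apply/(csimplex_cellP T'lam).
  by have /osimplex_csimplex/(csimplexP T'lam _ F'T')[] := xF'.
have : (csimplex T `&` csimplex T') x by [].
rewrite cell_conforming// => /(csimplexP Tlam _ (finset.subsetIl _ _))[_ xTT'].
have /(osimplexP Tlam _ (subD1set T w))[xF0 xFw] := xF.
have FT' : T :\ w \subset T'.
  apply/fintype.subsetP => v vF; have := xF0 v vF; apply: contraTT => vT'.
  by rewrite xTT' ?ltxx// ?inE ?(negbTE vT') ?andbF//; move: vF; rewrite inE => /andP[].
have TT' : T' = T by apply: (boundary_cell TC T'C bF) => //; exact: subD1set.
rewrite TT' in F'T' *.
have /(osimplexP Tlam _ F'T')[xF'0 xF'w] := xF'.
suff -> : F' = T :\ w by [].
apply/setP => v; have [vT|vT] := boolP (v \in T); last first.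
  by rewrite !inE (negbTE vT) andbF; apply: contraNF vT; exact: fintype.subsetP.
apply/idP/idP => [/xF'0|/xF0]; apply: contraTT => vF.
  by rewrite (xFw v vT vF) ltxx.
by rewrite (xF'w v vT vF) ltxx.
Qed.

(** By contradiction: when c T is minimal and smaller than all the data, each
    term of the cell equation is compared with the same term where the value
    involved is replaced by c T, and the flux balance cancels the result. The
    upper bound B only provides integrable dominating functions. *)
Lemma minimal_cell_bound T K B : T \in cells m ->
  (forall S, S \in cells m -> c T <= c S) ->
  (forall x, osimplex T x -> K <= Cold T x <= B) ->
  (forall x, Gamma_minus m Om U x -> K <= cI x <= B) ->
  (forall x, Om x -> 0 < f x -> K <= ct x <= B) -> K <= c T.
Proof.
move=> TC cmin CoK cIK ctK; rewrite leNgt; apply/negP => cK.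
have [lam Tlam] := cell_bary TC; have [cT _] := cell_is_cell TC.
have mT := measurable_osimplex Tlam.
have icst (g : R) : mu.-integrable (osimplex T) (EFin \o (fun=> g)).
  by apply: (@bounded_integrable _ _ _ _ _ _ `|g|) => //; exact: osimplex_lty Tlam.
have if_ : mu.-integrable (osimplex T) (EFin \o f).
  apply: integrableS hf => //; first exact: open_measurable_rV open_domain.
  exact: (osimplex_domain (ltn0Sn n) hm).
pose N := fine (mu (osimplex T)).
have N0 : 0 < N.
  by rewrite fine_gt0// (osimplex_gt0 Tlam) ?cT// (osimplex_lty Tlam).
have volC : \int[mu]_(x in osimplex T) (dt^-1 * C T x) = dt^-1 * c T * N.
  under eq_Rintegral do rewrite Cc//; by rewrite Rintegral_cst.
have absB x : K <= x <= B -> `|x| <= `|K| + `|B|.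
  move=> /andP[Kx xB]; rewrite ler_norml.
  have := ler_norm (- K); rewrite normrN; have := ler_norm B.
  have := normr_ge0 K; have := normr_ge0 B => *; apply/andP; split; lra.
have volOld : dt^-1 * K * N <= \int[mu]_(x in osimplex T) (dt^-1 * Cold T x).
  rewrite /N -Rintegral_cst//.
  apply: (@Rintegral_mono _ _ _ _ _ _ _ (fun=> dt^-1 * (`|K| + `|B|))) => //.
  - by move=> x _; rewrite normrM gtr0_norm ?invr_gt0// ler_wpM2l ?invr_ge0 ?(ltW dt0)// lerDl.
  - move=> x Tx; rewrite normrM gtr0_norm ?invr_gt0// ler_wpM2l ?invr_ge0 ?(ltW dt0)//.
    exact/absB/CoK.
  - move=> x Tx; rewrite ler_wpM2l ?invr_ge0 ?(ltW dt0)//.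
    by have /andP[] := CoK x Tx.
have source : c T * \int[mu]_(x in osimplex T) f x <=
    \int[mu]_(x in osimplex T) (f x * C_star f ct C T x).
  rewrite -RintegralZl//.
  apply: (@Rintegral_mono _ _ _ _ _ _ _ (fun x => (`|c T| + (`|K| + `|B|)) * `|f x|)) => //.
  - by have := @integrableZl _ _ _ _ _ mT (`|c T| + (`|K| + `|B|)) _ (integrable_norm if_).
  - by move=> x _; rewrite normrM ler_wpM2r// lerDl addr_ge0.
  - move=> x Tx; rewrite /C_star normrM mulrC ler_wpM2r//; case: ifPn => fx.
      apply: le_trans (absB _ (ctK x (osimplex_domain (ltn0Sn n) hm TC Tx) fx)) _.
      by rewrite lerDr.
    by rewrite Cc// lerDl addr_ge0.
  - move=> x Tx; rewrite /C_star mulrC; case: ifPn => fx; last by rewrite Cc.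
    rewrite ler_wpM2l ?(ltW fx)// (le_trans (ltW cK))//.
    by have /andP[] := ctK x (osimplex_domain (ltn0Sn n) hm TC Tx) fx.
have outflow : \sum_(w in T | ~~ inflow (T :\ w)) face_integral (T :\ w)
      (fun x => dotp (upwind U (T :\ w) C x) (outward_normal T (T :\ w))) <=
    c T * \sum_(w in T | ~~ inflow (T :\ w)) face_integral (T :\ w) (un T w).
  rewrite mulr_sumr; apply: ler_sum => w /andP[wT _]; rewrite -face_integralZ//.
  have [bF|iF] := face_neighbors TC wT.
    rewrite le_eqVlt; apply/orP; left; apply/eqP; congr face_integral.
    by apply/funext => x; exact: upwind_boundary.
  (* The neighbour in upwind_interior depends on the point; L bounds all cell
     values. *)
  pose L := \sum_(S in cells m) `|c S|.
  have cL S : S \in cells m -> `|c S| <= L.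
    by move=> SC; rewrite /L (bigD1 S)//= lerDl sumr_ge0.
  apply: (face_integral_mono (B := L)) => //.
  - move=> x _; have [S SC ->] := upwind_interior x TC wT iF.
    by rewrite normrM ler_wpM2r//; case: ifP => _; exact: cL.
  - by move=> x _; rewrite normrM ler_wpM2r// cL.
  - move=> x _; have [S SC ->] := upwind_interior x TC wT iF.
    by case: ifPn => //; rewrite -ltNge => u0; rewrite ler_wnM2r ?(ltW u0)// cmin.
have inflowE : c T * \sum_(w in T | inflow (T :\ w)) face_integral (T :\ w) (un T w) >=
    \sum_(w in T | inflow (T :\ w)) face_integral (T :\ w) (fun x => un T w x * cI x).
  rewrite mulr_sumr; apply: ler_sum => w /andP[wT Fin]; rewrite -face_integralZ//.
  apply: (face_integral_mono (B := `|c T| + (`|K| + `|B|))) => //.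
  - move=> x xF; have [_ Gx] := inflow_faceP TC wT Fin xF.
    rewrite normrM mulrC ler_wpM2r// (le_trans (absB _ (cIK x Gx)))// lerDr//.
  - by move=> x _; rewrite normrM ler_wpM2r// lerDl addr_ge0.
  - move=> x xF; have [un0 Gx] := inflow_faceP TC wT Fin xF.
    rewrite mulrC ler_wnM2r ?(ltW un0)// (le_trans (ltW cK))//.
    by have /andP[] := cIK x Gx.
have := flux_balance TC; rewrite (bigID (fun w => inflow (T :\ w)))/=.
move: (cell_equation TC) outflow inflowE source volOld; rewrite volC.
move: (\sum_(w in T | _) _) (\sum_(w in T | _) _) => E1 E2.
move: (\sum_(w in T | _) _) (\sum_(w in T | _) _) => E3 E4.
move: (Rintegral _ _ _) (Rintegral _ _ _) (Rintegral _ _ _) => I1 I2 I3.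
have : dt^-1 * c T * N < dt^-1 * K * N.
  by rewrite ltr_pM2r// ltr_pM2l// invr_gt0.
move=> h0 h1 h2 h3 h4 h5 h6; nra.
Qed.

End step.

Lemma BMS_step_lower_bound dt ct cI Cold C K B : 0 < dt ->
  BMS_step Om U f ct cI dt Cold C ->
  (forall T x, T \in cells m -> osimplex T x -> K <= Cold T x <= B) ->
  (forall x, Gamma_minus m Om U x -> K <= cI x <= B) ->
  (forall x, Om x -> 0 < f x -> K <= ct x <= B) ->
  forall T x, T \in cells m -> K <= C T x.
Proof.
move=> dt0 hC CoK cIK ctK T x TC.
have Cc S y : S \in cells m -> C S y = C S 0.
  by have [+ _] := hC => /[apply] -[a aE]; rewrite !aE.
rewrite Cc//; have [T1 T1C T1min] := arg_minP (fun S => C S 0) TC.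
apply: le_trans (T1min T TC).
by apply: (minimal_cell_bound dt0 hC Cc T1C T1min _ cIK ctK) => y; exact: CoK.
Qed.

End one_step.

Section opposite_data.
Context {R : realType} {d : nat}.
Variables (m : mesh R d) (U : 'rV[R]_d -> 'rV[R]_d).
Implicit Types (F : {set node m}) (C w : broken m).

Lemma face_integral_oppr F (h : 'rV[R]_d -> R) :
  face_integral F (fun x => - h x) = - face_integral F h.
Proof. by rewrite /face_integral Rintegral_oppr mulrN. Qed.

Lemma upwind_oppr F C x : upwind U F (fun T y => - C T y) x = - upwind U F C x.
Proof.
rewrite /upwind /average /jump opprD; congr (_ + _).
  rewrite -scalerN -sumrN; congr (_ *: _).
  by apply: eq_bigr => T _; rewrite scaleNr.
case: ifP => _; last by rewrite oppr0.
rewrite -scalerN -sumrN; congr (_ *: _).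
by apply: eq_bigr => T _; rewrite scaleNr.
Qed.

Lemma BMS_step_oppr (Om : set 'rV[R]_d) f ct cI dt Cold C :
  BMS_step Om U f ct cI dt Cold C ->
  BMS_step Om U f (fun x => - ct x) (fun x => - cI x) dt
    (fun T x => - Cold T x) (fun T x => - C T x).
Proof.
move=> [VC eqC]; split=> [T /VC[a aE]|w /eqC E]; first by exists (- a) => x; rewrite aE.
have volN (g h : broken m) : (forall T x, g T x = - h T x) ->
    \sum_(T in cells m) \int[lebesgue_rV d]_(x in osimplex T) g T x =
    - \sum_(T in cells m) \int[lebesgue_rV d]_(x in osimplex T) h T x.
  move=> gh; rewrite -sumrN; apply: eq_bigr => T _; rewrite -Rintegral_oppr.
  by apply: eq_Rintegral => x _.
have faceN (P : pred {set node m}) (g h : {set node m} -> 'rV[R]_d -> R) :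
    (forall F x, g F x = - h F x) ->
    \sum_(F | P F) face_integral F (g F) = - \sum_(F | P F) face_integral F (h F).
  move=> gh; rewrite -sumrN; apply: eq_bigr => F _; rewrite -face_integral_oppr.
  by congr face_integral; apply/funext => x.
have Csign T x : C_star f (fun x => - ct x) (fun T x => - C T x) T x =
    - C_star f ct C T x by rewrite /C_star; case: ifP.
move/(congr1 -%R): E; rewrite !opprD => E; apply: (etrans (etrans _ E)).
  congr (_ + _); first by apply: volN => T x; ring.
  by apply: faceN => F x; rewrite upwind_oppr dotpNl.
congr (_ + _ + _); [apply: esym; apply: volN => T x..|congr (- _); apply: esym].
- by rewrite Csign; ring.
- by ring.
- by apply: faceN => F x; rewrite -sumrN; apply: eq_bigr => T _; ring.
Qed.

End opposite_data.

(** * The discrete maximum principle *)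

(** The lower bound, applied to the problem with the data and to the one with
    the opposite data. *)
Lemma BMS_step_bounds (R : realType) (d : nat) (m : mesh R d) (Om : set 'rV[R]_d)
    (U : 'rV[R]_d -> 'rV[R]_d) (DU : 'rV[R]_d -> 'M[R]_d) (f : 'rV[R]_d -> R)
    (k : nat) (dt : R) (ct cI : 'rV[R]_d -> R) (Cold C : broken m) (M : R) :
  (0 < d)%N -> triangulation m Om -> W1oo Om U DU ->
  {within closure Om, continuous U} ->
  (lebesgue_rV d).-integrable Om (EFin \o f) -> locally_conservative m k DU f ->
  0 < dt -> BMS_step Om U f ct cI dt Cold C ->
  (forall T x, T \in cells m -> osimplex T x -> 0 <= Cold T x <= M) ->
  (forall x, Gamma_minus m Om U x -> 0 <= cI x <= M) ->
  (forall x, Om x -> 0 < f x -> 0 <= ct x <= M) ->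
  forall T x, T \in cells m -> 0 <= C T x <= M.
Proof.
case: d m Om U DU f ct cI Cold C => [//|n] m Om U DU f ct cI Cold C _.
move=> hm hU hUc hf hcons dt0 hC hCold hcI hct T x TC; apply/andP; split.
  exact: (BMS_step_lower_bound hm hU hUc hf hcons dt0 hC hCold hcI hct).
have opp_range (y : R) : 0 <= y <= M -> - M <= - y <= 0.
  by move=> /andP[y0 yM]; rewrite lerN2 yM oppr_le0.
rewrite -lerN2; apply: (BMS_step_lower_bound hm hU hUc hf hcons dt0 (BMS_step_oppr hC)) TC.
- by move=> S y SC Sy; exact/opp_range/hCold.
- by move=> y Gy; exact/opp_range/hcI.
- by move=> y Oy fy; exact/opp_range/hct.
Qed.

Lemma data_max_ge (R : realType) (d : nat) (Om Gm : set 'rV[R]_d) (Tf : R)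
    (f c0 : 'rV[R]_d -> R) (cI ct : R -> 'rV[R]_d -> R) (M : R) :
  data_max Om Gm Tf f c0 cI ct = M%:E ->
  [/\ forall x, Om x -> c0 x <= M,
      forall t x, 0 < t <= Tf -> Gm x -> cI t x <= M &
      forall t x, 0 < t <= Tf -> Om x -> 0 < f x -> ct t x <= M].
Proof.
have abs_le (y : R) (A : set (\bar R)) : A `|y|%:E -> (ereal_sup A <= M%:E)%E -> y <= M.
  move=> Ay AM; apply: le_trans (ler_norm y) _; rewrite -lee_fin.
  exact: le_trans (ereal_sup_ubound Ay) AM.
rewrite /data_max => hM; have := lexx M%:E; rewrite -{1}hM !ge_max.
move=> /andP[h0 /andP[hI ht]]; split.
- by move=> x Ox; apply: abs_le h0; exists x.
- by move=> t x tT Gx; apply: abs_le hI; exists t, x.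
- by move=> t x tT Ox fx; apply: abs_le ht; exists t, x.
Qed.

Theorem theorem4p7 (R : realType) (d : nat) (hd : d = 2%N \/ d = 3%N)
    (Om : set 'rV[R]_d) (m : mesh R d) (hm : triangulation m Om)
    (kappa : R) (hkappa : shape_regular m kappa)
    (* the flux, identified with its continuous representative *)
    (U : 'rV[R]_d -> 'rV[R]_d) (DU : 'rV[R]_d -> 'M[R]_d)
    (hU : W1oo Om U DU) (hUc : {within closure Om, continuous U})
    (hUsign : constant_sign m U)
    (f : 'rV[R]_d -> R)
    (hf : (lebesgue_rV d).-integrable Om (EFin \o f))
    (kc k : nat) (hkc : kc = 0%N) (hk : (2 * kc <= k)%N)
    (hcons : locally_conservative m k DU f)
    (Tf dt : R) (hTf : 0 < Tf) (hdt : 0 < dt)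
    (c0 : 'rV[R]_d -> R) (cI ct : R -> 'rV[R]_d -> R)
    (hc0m : measurable_fun Om c0)
    (hcIm : forall t, 0 < t <= Tf -> measurable_fun (Gamma_minus m Om U) (cI t))
    (hctm : forall t, 0 < t <= Tf ->
       measurable_fun [set x | Om x /\ 0 < f x] (ct t))
    (hc0 : forall x, Om x -> 0 <= c0 x)
    (hcI : forall t x, 0 < t <= Tf -> Gamma_minus m Om U x -> 0 <= cI t x)
    (hct : forall t x, 0 < t <= Tf -> Om x -> 0 < f x -> 0 <= ct t x)
    (M : R) (hM : data_max Om (Gamma_minus m Om U) Tf f c0 cI ct = M%:E)
    (* the numerical solution, C n being its value at time n * dt *)
    (C : nat -> broken m)
    (hC0 : forall T x, C 0%N T x = c0 x)
    (hC : forall n, n.+1%:R * dt <= Tf ->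
       BMS_step Om U f (ct (n.+1%:R * dt)) (cI (n.+1%:R * dt)) dt
         (C n) (C n.+1)) :
  forall n T x, n.+1%:R * dt <= Tf -> T \in cells m -> csimplex T x ->
    0 <= C n.+1 T x <= M.
Proof.
have [hM0 hMI hMt] := data_max_ge hM.
have d0 : (0 < d)%N by case: hd => ->.
have time n : n.+1%:R * dt <= Tf -> 0 < n.+1%:R * dt <= Tf.
  by move=> ->; rewrite mulr_gt0.
have initial T x : T \in cells m -> osimplex T x -> 0 <= C 0%N T x <= M.
  by move=> TC /(osimplex_domain d0 hm TC) Ox; rewrite hC0 hc0// hM0.
have step n : n.+1%:R * dt <= Tf ->
    (forall T x, T \in cells m -> osimplex T x -> 0 <= C n T x <= M) ->
    forall T x, T \in cells m -> 0 <= C n.+1 T x <= M.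
  move=> nT Cn.
  apply: (BMS_step_bounds d0 hm hU hUc hf hcons hdt (hC n nT) Cn) => x *.
    by rewrite hcI ?hMI ?time.
  by rewrite hct ?hMt ?time.
elim=> [|n IH] T x nT TC _; first by apply: step.
apply: step => // S y SC Sy; apply: IH => //; last by apply: osimplex_csimplex.
by apply: le_trans nT; rewrite ler_wpM2r ?(ltW hdt)// ler_nat.
Qed.
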